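(* Let $F:X\to Y$ be a linear operator between the finite-dimensional normed spaces $X=(\mathbb{R}^N,\|\cdot\|_X)$ and $Y=(\mathbb{R}^M,\|\cdot\|_Y)$. Suppose that $Y$ is uniformly smooth and that $\boldsymbol{y}\in\operatorname{Rg}(F)$, i.e. $F\boldsymbol{x}=\boldsymbol{y}$ is solvable. For $\delta>0$ let $\boldsymbol{y}^\delta\in Y$ satisfy $\|\boldsymbol{y}^\delta-\boldsymbol{y}\|_Y\le\delta$. Let $\mathcal{R}=\Phi^{uc}_\Theta:X\to(\mathbb{R},|\cdot|)$ be a continuous and uniformly convex neural network. Fix $r\in(1,\infty)$, $\tau>1$, $\boldsymbol{x}_0\in X$, $\boldsymbol{\xi}_0\in\partial\mathcal{R}(\boldsymbol{x}_0)$, and a sequence $\{\alpha_n\}_{n\ge1}$ of positive real numbers such that $\sum_{n=1}^\infty\alpha_n^{-1}=\infty$ and $\alpha_n\le c\,\alpha_{n+1}$ for all $n$, for some constant $c>0$. Consider the iNETT iteration: $\boldsymbol{x}^\delta_0=\boldsymbol{x}_0$, $\boldsymbol{\xi}^\delta_0=\boldsymbol{\xi}_0$ and, for $n\ge1$, $$\boldsymbol{x}^\delta_n=\underset{\boldsymbol{x}\in X}{\operatorname{argmin}}\ \frac1r\|F\boldsymbol{x}-\boldsymbol{y}^\delta\|_Y^r+\alpha_n\mathcal{B}^{\mathcal{R}}_{\boldsymbol{\xi}^\delta_{n-1}}(\boldsymbol{x},\boldsymbol{x}^\delta_{n-1}),\qquad \boldsymbol{\xi}^\delta_n=\boldsymbol{\xi}^\delta_{n-1}-\frac1{\alpha_n}F^TJ_r(F\boldsymbol{x}^\delta_n-\boldsymbol{y}^\delta).$$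 Then: 1. The iNETT method is well-posed. 2. There exists a unique $\mathcal{B}^{\mathcal{R}}_{\boldsymbol{\xi}_0}$-minimizing solution $\boldsymbol{x}^\dagger$ of $F\boldsymbol{x}=\boldsymbol{y}$. 3. The method coupled with the discrepancy principle, i.e. stopped at the first step $n_\delta=n$ such that $$\|F\boldsymbol{x}^\delta_n-\boldsymbol{y}^\delta\|_Y\le\tau\delta<\|F\boldsymbol{x}^\delta_{n-1}-\boldsymbol{y}^\delta\|_Y,$$ stops in finitely many steps, $n_\delta<\infty$, and converges to $\boldsymbol{x}^\dagger$ as $\delta\to0$. In particular, as $\delta\to0$, $$\boldsymbol{x}^\delta_{n_\delta}\to\boldsymbol{x}^\dagger,\qquad \mathcal{R}(\boldsymbol{x}^\delta_{n_\delta})\to\mathcal{R}(\boldsymbol{x}^\dagger),\qquad \mathcal{B}^{\mathcal{R}}_{\boldsymbol{\xi}^\delta_{n_\delta}}(\boldsymbol{x}^\dagger,\boldsymbol{x}^\delta_{n_\delta})\to0.$$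
   Context: $\langle\cdot,\cdot\rangle$ is the standard pairing $\langle\boldsymbol{\xi},\boldsymbol{x}\rangle=\sum_i\xi_ix_i$, by which the dual spaces $X^*,Y^*$ are identified with $\mathbb{R}^N,\mathbb{R}^M$ (with the dual norms); $F^T$ is the transpose. A space $Y$ is uniformly smooth if $\rho(\tau)=\sup\{\tfrac12(\|\boldsymbol{y}+\tau\hat{\boldsymbol{y}}\|+\|\boldsymbol{y}-\tau\hat{\boldsymbol{y}}\|)-1:\|\boldsymbol{y}\|=\|\hat{\boldsymbol{y}}\|=1\}$ satisfies $\lim_{\tau\to0^+}\rho(\tau)/\tau=0$. For $r\in(1,\infty)$ the duality map $J_r:Y\to2^{Y^*}$ is $J_r(\boldsymbol{y})=\{\boldsymbol{\xi}\in Y^*:\|\boldsymbol{\xi}\|=\|\boldsymbol{y}\|_Y^{r-1},\ \langle\boldsymbol{\xi},\boldsymbol{y}\rangle=\|\boldsymbol{y}\|_Y^r\}$, i.e. the subdifferential of $\boldsymbol{y}\mapsto\|\boldsymbol{y}\|_Y^r/r$; it is single-valued when $Y$ is uniformly smooth. $\mathcal{R}:X\to\mathbb{R}$ is uniformly convex if there is $h:[0,+\infty)\to[0,+\infty]$ with $h(s)=0$ iff $s=0$ and $\mathcal{R}(t\boldsymbol{x}+(1-t)\hat{\boldsymbol{x}})+t(1-t)h(\|\boldsymbol{x}-\hat{\boldsymbol{x}}\|_X)\le t\mathcal{R}(\boldsymbol{x})+(1-t)\mathcal{R}(\hat{\boldsymbol{x}})$ for all $t\in[0,1]$, $\boldsymbol{x},\hat{\boldsymbol{x}}\in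 X$. The subdifferential is $\partial\mathcal{R}(\hat{\boldsymbol{x}})=\{\boldsymbol{\xi}\in X^*:\mathcal{R}(\boldsymbol{x})-\mathcal{R}(\hat{\boldsymbol{x}})-\langle\boldsymbol{\xi},\boldsymbol{x}-\hat{\boldsymbol{x}}\rangle\ge0\ \forall\boldsymbol{x}\in X\}$. For $\boldsymbol{\xi}\in\partial\mathcal{R}(\hat{\boldsymbol{x}})$ the Bregman distance is $\mathcal{B}^{\mathcal{R}}_{\boldsymbol{\xi}}(\boldsymbol{x},\hat{\boldsymbol{x}})=\mathcal{R}(\boldsymbol{x})-\mathcal{R}(\hat{\boldsymbol{x}})-\langle\boldsymbol{\xi},\boldsymbol{x}-\hat{\boldsymbol{x}}\rangle$. A $\mathcal{B}^{\mathcal{R}}_{\boldsymbol{\xi}_0}$-minimizing solution of $F\boldsymbol{x}=\boldsymbol{y}$ is an element $\boldsymbol{x}^\dagger\in X$ with $F\boldsymbol{x}^\dagger=\boldsymbol{y}$ and $\mathcal{B}^{\mathcal{R}}_{\boldsymbol{\xi}_0}(\boldsymbol{x}^\dagger,\boldsymbol{x}_0)=\min\{\mathcal{B}^{\mathcal{R}}_{\boldsymbol{\xi}_0}(\boldsymbol{x},\boldsymbol{x}_0):\boldsymbol{x}\in X,\ F\boldsymbol{x}=\boldsymbol{y}\}$. ''Well-posed'' means that the iterates are well defined: at each step the minimizer $\boldsymbol{x}^\delta_n$ exists and is unique, $J_r$ is single-valued, and $\boldsymbol{\xi}^\delta_n\in\partial\mathcal{R}(\boldsymbol{x}^\delta_n)$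 (so that the next Bregman distance makes sense). In the stopping rule, $n_\delta$ is the smallest integer $n\ge0$ with $\|F\boldsymbol{x}^\delta_n-\boldsymbol{y}^\delta\|_Y\le\tau\delta$ (for $n_\delta=0$ the right-hand inequality is void). Neural network of depth $L$ with values in $\mathbb{R}$: a map $\Phi_\Theta:X\to\mathbb{R}$ of the form $\Phi_\Theta(\boldsymbol{x})=\boldsymbol{z}^{L+1}$, where $\boldsymbol{z}^1=\boldsymbol{x}$ and, for $k=1,\dots,L$, $\boldsymbol{z}^{k+1}=\sigma^k(\hat{\boldsymbol{b}}^k+W^k\hat{\boldsymbol{z}}^k)$, $\hat{\boldsymbol{b}}^k=\boldsymbol{b}^k+A^{k,j_k}\boldsymbol{z}^{j_k}$ with $j_k\in\{1,\dots,k\}$, and $\hat{\boldsymbol{z}}^k$ is either $\boldsymbol{z}^k$ or the concatenation of $\boldsymbol{z}^{i_k}$ and $\boldsymbol{z}^k$ for some $i_k\in\{1,\dots,k\}$; here $\boldsymbol{b}^k$ are vectors, $W^k,A^{k,j_k}$ matrices and $\sigma^k$ possibly nonlinear maps between finite-dimensional spaces, of compatible dimensions. *)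

(* Defs.v *)
From HB Require Import structures.
From mathcomp Require Import all_boot all_order all_algebra.
From mathcomp Require Import all_classical all_reals all_analysis.

Set Implicit Arguments.
Unset Strict Implicit.
Unset Printing Implicit Defensive.

Import Order.TTheory GRing.Theory Num.Theory.
Import numFieldNormedType.Exports.

Local Open Scope classical_set_scope.
Local Open Scope ring_scope.

Record vnorm (R : realType) (n : nat) := VNorm {
  vnorm_fun :> 'rV[R]_n -> R ;
  vnormD : forall x y, vnorm_fun (x + y) <= vnorm_fun x + vnorm_fun y ;
  vnormZ : forall a x, vnorm_fun (a *: x) = `|a| * vnorm_fun x ;
  vnorm_eq0 : forall x, vnorm_fun x = 0 -> x = 0 }.

(* R^n (row vectors) equipped with the norm nu.  The matrix type itself already
   carries the sup norm, so the norm nu and the topology it induces are put on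
   an alias; vectors for which no such norm is meant, in particular elements of
   the dual, have type 'rV[R]_n. *)
Definition normed_rV (R : realType) (n : nat) (nu : vnorm R n) : Type :=
  'rV[R]_n.

Section NormedRowVectors.
Variables (R : realType) (n : nat) (nu : vnorm R n).

HB.instance Definition _ := GRing.Lmodule.copy (normed_rV nu) 'rV[R]_n.

HB.instance Definition _ := @Lmodule_isNormed.Build R (normed_rV nu)
  nu (vnormD nu) (vnormZ nu) (vnorm_eq0 (v := nu)).

End NormedRowVectors.

Definition pairing (R : realType) (n : nat) (xi x : 'rV[R]_n) : R :=
  \sum_(i < n) xi 0 i * x 0 i.

Definition dual_norm (R : realType) (n : nat) (nu : vnorm R n)
    (xi : 'rV[R]_n) : R :=
  sup [set `|pairing xi x| | x in [set x : normed_rV nu | `|x| <= 1]].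

(* The transpose F^T : Y^* -> X^*.  On row vectors F is x |-> x *m lin1_mx F. *)
Definition transpose_op (R : realType) (N M : nat) (nuX : vnorm R N)
    (nuY : vnorm R M) (F : {linear normed_rV nuX -> normed_rV nuY})
    (eta : 'rV[R]_M) : 'rV[R]_N :=
  eta *m (lin1_mx (F : 'rV[R]_N -> 'rV[R]_M))^T.

Definition smoothness_modulus (R : realType) (V : normedModType R)
    (tau : R) : R :=
  sup [set 2^-1 * (`|p.1 + tau *: p.2| + `|p.1 - tau *: p.2|) - 1
      | p in [set p : V * V | `|p.1| = 1 /\ `|p.2| = 1]].

Definition uniformly_smooth (R : realType) (V : normedModType R) : Prop :=
  smoothness_modulus V tau / tau @[tau --> 0^'+] --> (0 : R).

(* The modulus h takes values in [0, +oo]; only its values at s >= 0 matter. *)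
Definition uniformly_convex (R : realType) (V : normedModType R)
    (f : V -> R) : Prop :=
  exists h : R -> \bar R,
    [/\ (forall s : R, 0 <= s -> (0 <= h s)%E),
        (forall s : R, 0 <= s -> (h s = 0%E <-> s = 0)) &
        (forall (t : R) (x x' : V), 0 <= t <= 1 ->
          ((f (t *: x + (1 - t) *: x')%R)%:E
             + (t * (1 - t))%R%:E * h `|x - x'|%R
           <= (t * f x + (1 - t) * f x')%R%:E)%E)].

Definition duality_map (R : realType) (n : nat) (nu : vnorm R n) (r : R)
    (y : normed_rV nu) : set 'rV[R]_n :=
  [set xi | dual_norm nu xi = `|y| `^ (r - 1) /\ pairing xi y = `|y| `^ r].

Section Regularizer.
Variables (R : realType) (N : nat) (nu : vnorm R N).
Local Notation X := (normed_rV nu).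
Variable Phi : X -> R.

Definition bregman (xi : 'rV[R]_N) (x x' : X) : R :=
  Phi x - Phi x' - pairing xi (x - x').

Definition subdifferential (x' : X) : set 'rV[R]_N :=
  [set xi | forall x : X, 0 <= Phi x - Phi x' - pairing xi (x - x')].

End Regularizer.

Definition argmin (R : realType) (T : Type) (f : T -> R) : set T :=
  [set x | forall x', f x <= f x'].

(* Neural networks.  Features are numbered from 0: z_0 is the input, layer k
   (k < L) produces z_(k+1) from z_0, ..., z_k, and z_L is the output.  Vectors
   are rows, so that weight matrices act on the right. *)
Section NeuralNetwork.
Variable R : realType.

Definition layer_input_dim (d : nat -> nat) (k : nat)
    (s : option 'I_k.+1) : nat :=
  if s is Some i then (d i + d k)%N else d k.

Record layer (d : nat -> nat) (k : nat) := Layer {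
  width : nat ;
  bias : 'rV[R]_width ;
  bias_src : 'I_k.+1 ;
  bias_weight : 'M[R]_(d bias_src, width) ;
  concat_src : option 'I_k.+1 ;
  weight : 'M[R]_(layer_input_dim d concat_src, width) ;
  activation : 'rV[R]_width -> 'rV[R]_(d k.+1) }.

Arguments activation {d k} l _.

Definition layer_input (d : nat -> nat) (z : forall i, 'rV[R]_(d i)) (k : nat)
    (s : option 'I_k.+1) : 'rV[R]_(layer_input_dim d s) :=
  match s with
  | Some i => row_mx (z i) (z k)
  | None => z k
  end.

Definition layer_output (d : nat -> nat) (k : nat) (l : layer d k)
    (z : forall i, 'rV[R]_(d i)) : 'rV[R]_(d k.+1) :=
  activation l (bias l + z (bias_src l) *m bias_weight l
                + layer_input z (concat_src l) *m weight l).

(* [features l x k i] is z_i whenever i <= k, and 0 for i > k. *)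
Fixpoint features (d : nat -> nat) (l : forall k, layer d k)
    (x : 'rV[R]_(d 0)) (k : nat) : forall i, 'rV[R]_(d i) :=
  if k is k'.+1 then
    let z := features l x k' in dfwith z k'.+1 (layer_output (l k') z)
  else dfwith (T := fun i => 'rV[R]_(d i)) (fun=> 0) 0%N x.

(* [w k] is the dimension of z_(k+1). *)
Definition feature_dim (N : nat) (w : nat -> nat) (k : nat) : nat :=
  if k is k'.+1 then w k' else N.

(* Only the layers of index k < L contribute.  The index i ranges over the
   single coordinate of the output space R^1 = R. *)
Definition neural_network (N : nat) (Phi : 'rV[R]_N -> R) : Prop :=
  exists (L : nat) (w : nat -> nat)
         (l : forall k, layer (feature_dim N w) k),
    [/\ (0 < L)%N, feature_dim N w L = 1%N &
        forall (x : 'rV[R]_N) (i : 'I_(feature_dim N w L)),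
          Phi x = features l x L L 0 i].

End NeuralNetwork.

Section INETT.
Variables (R : realType) (N M : nat) (nuX : vnorm R N) (nuY : vnorm R M).
Local Notation X := (normed_rV nuX).
Local Notation Y := (normed_rV nuY).
Variables (F : {linear X -> Y}) (Phi : X -> R).

Definition minimizing_solution (xi0 : 'rV[R]_N) (x0 : X) (y : Y) (x : X) :
    Prop :=
  F x = y /\
  forall x' : X, F x' = y -> bregman Phi xi0 x x0 <= bregman Phi xi0 x' x0.

Variables (r : R) (alpha : nat -> R) (x0 : X) (xi0 : 'rV[R]_N).

Definition inett_functional (ydelta : Y) (a : R) (p : X * 'rV[R]_N) (x : X) :
    R :=
  r^-1 * `|F x - ydelta| `^ r + a * bregman Phi p.2 x p.1.

(* The n-th iterate (x_n, xi_n) for the datum ydelta.  [xget 0 A] is an element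
   of A if there is one and 0 otherwise; [inett_well_posed] states that each of
   the sets it is applied to is a singleton. *)
Fixpoint inett (ydelta : Y) (n : nat) : X * 'rV[R]_N :=
  if n is n'.+1 then
    let p := inett ydelta n' in
    let x := xget 0 (argmin (inett_functional ydelta (alpha n'.+1) p)) in
    let eta := xget 0 (duality_map r (F x - ydelta)) in
    (x, p.2 - (alpha n'.+1)^-1 *: transpose_op F eta)
  else (x0, xi0).

Definition inett_well_posed (ydelta : Y) : Prop :=
  [/\ (forall y : Y, exists! eta, duality_map r y eta),
      (forall n, exists! x,
         argmin (inett_functional ydelta (alpha n.+1) (inett ydelta n)) x) &
      (forall n, subdifferential Phi (inett ydelta n).1 (inett ydelta n).2)].

Definition discrepancy_stop (tau delta : R) (ydelta : Y) (n : nat) : Prop :=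
  `|F (inett ydelta n).1 - ydelta| <= tau * delta /\
  forall m, (m < n)%N -> tau * delta < `|F (inett ydelta m).1 - ydelta|.

End INETT.

(* Main.v *)
Require Import Defs.
From HB Require Import structures.
From mathcomp Require Import all_boot all_order all_algebra.
From mathcomp Require Import all_classical all_reals all_analysis.
From mathcomp Require Import ring lra.

Set Implicit Arguments.
Unset Strict Implicit.
Unset Printing Implicit Defensive.

Import Order.TTheory GRing.Theory Num.Theory.
Import numFieldNormedType.Exports.

Local Open Scope classical_set_scope.
Local Open Scope ring_scope.

(* The convergence is read off the Bregman distances
   [Delta_n = B_(zeta_n)(xdag, u_n)] of the iterates [(u_n, zeta_n)], with
   residuals [res_n = |F u_n - ydelta|].  Before the discrepancy principle stops
   the iteration, [Delta_n] decreases by at least a multiple of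
   [res_n^r / alpha_n], and since [sum 1/alpha_n] diverges this forces the
   residuals to become small, uniformly in the data.  As [zeta_n] differs from
   [xi0] by some [F^T lambda_n],
     [Delta_n = (B_xi0(xdag, x0) - B_xi0(u_n, x0)) + <lambda_n, y - F u_n>].
   In finite dimension the bracket is small as soon as [F u_n] is close to [y].
   The pairing is controlled by the decrease of [Delta] between two indices
   [j < m], up to a term that is small for [m] large: so either [Delta] drops
   by a fixed amount between [j] and [m], which can happen only a bounded number
   of times, or [Delta_m] is small.  Hence [Delta] becomes small at an index that
   depends neither on the noise level nor on the data, and neither subsequences
   nor stability of the iterates are needed.  The condition
   [alpha_n <= c alpha_(n+1)] controls the last step, at which [Delta] may
   increase. *)

(** * Norms on [R^n]: equivalence, compactness, minimization, pairing and dual norm *)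

Section FiniteDimension.
Variables (R : realType) (n : nat) (nu : vnorm R n).
Local Notation X := (normed_rV nu).

Lemma normed_rVE (x : X) : `|x| = nu x. Proof. by []. Qed.

Lemma le_coord_mx_norm (x : 'rV[R]_n) i : `|x 0 i| <= `|x|.
Proof.
rewrite [leRHS]/Num.norm /= mx_normrE; apply/bigmax_geP; right => /=.
by exists (0, i).
Qed.

Lemma vnorm_le_mx_norm :
  exists2 C : R, 0 < C & forall x : 'rV[R]_n, nu x <= C * `|x|.
Proof.
exists (1 + \sum_i nu (delta_mx 0 i)).
  by rewrite ltr_pwDl// sumr_ge0// => i _; rewrite -normed_rVE.
move=> x; have: nu x <= \sum_i `|x 0 i| * nu (delta_mx 0 i).
  rewrite {1}(row_sum_delta x); apply: (big_ind2 (fun (u : 'rV_n) (a : R) => nu u <= a)).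
  - by rewrite -normed_rVE normr0.
  - move=> u a v b ua vb; exact: (le_trans (vnormD nu u v) (lerD ua vb)).
  - by move=> i _; rewrite vnormZ.
move/le_trans; apply; rewrite mulrDl mul1r mulr_suml ler_wpDl//.
apply: ler_sum => i _; rewrite mulrC ler_wpM2l//; last exact: le_coord_mx_norm.
by rewrite -normed_rVE.
Qed.

Lemma vnorm_continuous : continuous (nu : 'rV[R]_n -> R).
Proof.
have [C C0 hC] := vnorm_le_mx_norm.
move=> x; apply/(@cvgrPdist_le _ _ _ (nbhs x)) => e e0; near=> z.
have: `|nu x - nu z| <= nu (x - z) by exact: (@ler_dist_dist R X x z).
move/le_trans; apply; rewrite (le_trans (hC _))//.
rewrite -ler_pdivlMl//; near: z.
by apply: (cvgr_dist_le id x) => //; rewrite mulr_gt0// invr_gt0.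
Unshelve. all: by end_near. Qed.

(** By homogeneity it suffices to bound [nu] from below on the sup-norm unit sphere, where
    compactness provides a minimum, positive by definiteness. *)
Lemma mx_norm_le_vnorm :
  exists2 c : R, 0 < c & forall x : 'rV[R]_n, `|x| <= c * nu x.
Proof.
pose S := [set x : 'rV[R]_n | `|x| = 1].
have cS : compact S.
  apply: bounded_closed_compact.
    by exists 1; split => // t t1 x /= ->; exact: ltW.
  apply: (@preimage_closed _ _ (fun x : 'rV[R]_n => `|x|) [set x : R | x = 1]).
    by move=> x _; exact: norm_continuous.
  exact: closed_eq.
have nz x : nu x = 0 -> x = 0 by exact: vnorm_eq0.
have scal (x : 'rV[R]_n) : x != 0 -> S (`|x|^-1 *: x).
  by move=> x0; rewrite /S/= normrZ normfV normr_id mulVf// normr_eq0.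
(* The sphere may be empty ([n = 0]); then every vector is 0. *)
have [[x1 Sx1]|S0] := pselect (S !=set0); last first.
  exists 1 => // x; have [->|x0] := eqVneq x 0.
    by rewrite normr0 mul1r -normed_rVE.
  by exfalso; apply: S0; exists (`|x|^-1 *: x); exact: scal.
have [||a /set_mem Sa mina] := EVT_min_rV (f := nu) _ cS.
- by exists x1.
- by apply: continuous_subspaceT => x; exact: vnorm_continuous.
have a0 : 0 < nu a.
  rewrite lt0r -{2}normed_rVE normr_ge0 andbT; apply/eqP => /nz a0.
  by move: Sa; rewrite /S/= a0 normr0 => /eqP; rewrite eq_sym oner_eq0.
exists (nu a)^-1; first by rewrite invr_gt0.
move=> x; have [->|x0] := eqVneq x 0.
  by rewrite normr0 mulr_ge0// ?invr_ge0 -normed_rVE.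
have nx0 : 0 < `|x| by rewrite normr_gt0.
have := mina _ (mem_set (scal _ x0)).
by rewrite vnormZ normfV normr_id mulrC ler_pdivlMr// ler_pdivlMl.
Qed.

(** Heine-Borel for the topology of [nu]: [A] is a closed subset of the image of a compact sup-norm
    ball under the identity, which is continuous from the sup norm to [nu]. *)
Lemma normed_rV_compact (A : set X) (B : R) :
  closed A -> (forall x, A x -> `|x| <= B) -> compact A.
Proof.
move=> cA hB.
have [C C0 hC] := vnorm_le_mx_norm; have [c c0 hc] := mx_norm_le_vnorm.
pose K := [set x : 'rV[R]_n | `|x| <= c * B].
have cK : compact K.
  apply: bounded_closed_compact.
    exists (c * B); split; first exact: num_real.
    by move=> t t1 x /= /le_trans; apply; exact: ltW.
  apply: (@preimage_closed _ _ (fun x : 'rV[R]_n => `|x|) [set x : R | x <= c * B]).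
    by move=> x _; exact: norm_continuous.
  exact: closed_le.
apply: (@subclosed_compact _ _ ((fun x : 'rV[R]_n => x : X) @` K)) => //.
  apply: continuous_compact => //.
  apply: continuous_subspaceT => x.
  apply/(@cvgrPdist_le _ X _ (nbhs x)) => e e0; near=> z.
  rewrite normed_rVE (le_trans (hC _))// -ler_pdivlMl//; near: z.
  by apply: (cvgr_dist_le id x) => //; rewrite mulr_gt0// invr_gt0.
move=> x Ax; exists (x : 'rV[R]_n) => //=.
by rewrite /K/= (le_trans (hc _))// ler_pM2l// -normed_rVE hB.
Unshelve. all: by end_near. Qed.

(** The direct method: [f] attains its minimum on the sublevel set of [f a] in [A], compact by the
    bound, and its values on the rest of [A] are larger. *)
Lemma coercive_min (A : set X) (f : X -> R) (a : X) (B : R) :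
  closed A -> continuous f -> A a ->
  (forall x, A x -> f x <= f a -> `|x| <= B) ->
  exists2 m, A m & forall x, A x -> f m <= f x.
Proof.
move=> cA cf Aa hB; pose S := A `&` [set x | f x <= f a].
have cS : compact S.
  apply: (@normed_rV_compact _ B); last by move=> x [Ax]; exact: hB.
  apply: closedI => //.
  apply: (@preimage_closed _ _ f [set x : R | x <= f a]); last exact: closed_le.
  by move=> x _; exact: cf.
have [||m /set_mem[Am fm] minm] := @compact_EVT_min _ _ f S _ cS.
- by exists a; split => //=.
- exact: continuous_subspaceT.
exists m => // x Ax; have [xa|/ltW ax] := leP (f x) (f a).
  by apply: minm; apply/mem_set.
exact: le_trans ax.
Qed.

Lemma coord_le_norm : exists2 c : R, 0 < c & forall (x : X) i, `|x 0 i| <= c * `|x|.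
Proof.
have [c c0 hc] := mx_norm_le_vnorm.
by exists c => // x i; exact: (le_trans (le_coord_mx_norm _ _) (hc _)).
Qed.

Lemma linear_continuous_rV (V : normedModType R) (f : {linear X -> V}) :
  continuous f.
Proof.
have [c c0 hc] := coord_le_norm.
apply/linear_bounded_continuous/linear_boundedP.
pose S := \sum_i `|f (delta_mx 0 i : X)|.
have S0 : 0 <= S by exact: sumr_ge0.
near=> t => x.
have xE : x = \sum_i x 0 i *: (delta_mx 0 i : X) by exact: row_sum_delta.
rewrite {1}xE linear_sum/= (le_trans (ler_norm_sum _ _ _))//.
apply: (@le_trans _ _ (c * S * `|x|)).
  rewrite /S mulr_sumr mulr_suml; apply: ler_sum => i _.
  by rewrite linearZ normrZ mulrAC ler_wpM2r.
by apply: ler_wpM2r => //; near: t; apply: nbhs_pinfty_ge; exact: num_real.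
Unshelve. all: by end_near. Qed.

Lemma pairing_mulmx (xi x : 'rV[R]_n) : pairing xi x = (xi *m x^T) 0 0.
Proof. by rewrite mxE; apply: eq_bigr => i _; rewrite mxE. Qed.

Lemma pairingDl (a b x : 'rV[R]_n) : pairing (a + b) x = pairing a x + pairing b x.
Proof. by rewrite !pairing_mulmx mulmxDl mxE. Qed.

Lemma pairingZl k (a x : 'rV[R]_n) : pairing (k *: a) x = k * pairing a x.
Proof. by rewrite !pairing_mulmx -scalemxAl mxE. Qed.

Lemma pairingDr (a x y : 'rV[R]_n) : pairing a (x + y) = pairing a x + pairing a y.
Proof. by rewrite !pairing_mulmx linearD mulmxDr mxE. Qed.

Lemma pairingZr k (a x : 'rV[R]_n) : pairing a (k *: x) = k * pairing a x.
Proof. by rewrite !pairing_mulmx linearZ -scalemxAr mxE. Qed.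

Lemma pairingNl (a x : 'rV[R]_n) : pairing (- a) x = - pairing a x.
Proof. by rewrite -scaleN1r pairingZl mulN1r. Qed.

Lemma pairingNr (a x : 'rV[R]_n) : pairing a (- x) = - pairing a x.
Proof. by rewrite -scaleN1r pairingZr mulN1r. Qed.

Lemma pairing0l (x : 'rV[R]_n) : pairing 0 x = 0.
Proof. by rewrite -(scale0r (0 : 'rV_n)) pairingZl mul0r. Qed.

Lemma pairing0r (a : 'rV[R]_n) : pairing a 0 = 0.
Proof. by rewrite -(scale0r (0 : 'rV_n)) pairingZr mul0r. Qed.

Lemma pairing_delta (a : 'rV[R]_n) i : pairing a (delta_mx 0 i) = a 0 i.
Proof.
rewrite /pairing (bigD1 i)//= big1 => [|j ji]; rewrite mxE !eqxx ?mulr1 ?addr0//.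
by rewrite (negbTE ji) mulr0.
Qed.

Lemma pairing_continuous (xi : 'rV[R]_n) : continuous (pairing xi : X -> R).
Proof.
pose f := GRing.isLinear.Build R X R _ (pairing xi : X -> R) (fun k x y =>
  etrans (pairingDr xi (k *: x) y) (congr1 (+%R^~ _) (pairingZr k xi x))).
pose F : {linear X -> R} := HB.pack (pairing xi : X -> R) f.
exact: (@linear_continuous_rV _ F).
Qed.

(** [sup] is a true supremum only for nonempty sets bounded above; this is what makes [dual_norm]
    usable. *)
Lemma has_sup_dual_norm (xi : 'rV[R]_n) :
  has_sup [set `|pairing xi x| | x in [set x : X | `|x| <= 1]].
Proof.
split; first by exists `|pairing xi 0|, 0 => //=; rewrite normr0.
have [c c0 hc] := coord_le_norm.
exists (\sum_i `|xi 0 i| * c) => _ [x /= x1 <-].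
rewrite (le_trans (ler_norm_sum _ _ _))//; apply: ler_sum => i _.
rewrite normrM ler_wpM2l// (le_trans (hc x i))//.
by rewrite -[leRHS]mulr1 ler_pM2l.
Qed.

Lemma ler_pairing (xi : 'rV[R]_n) (x : X) :
  `|pairing xi x| <= dual_norm nu xi * `|x|.
Proof.
have [->|x0] := eqVneq x 0.
  by rewrite pairing0r !normr0 mulr0.
have nx0 : 0 < `|x| by rewrite normr_gt0.
have : `|pairing xi (`|x|^-1 *: x)| <= dual_norm nu xi.
  apply: ub_le_sup; first exact: (has_sup_dual_norm xi).2.
  by exists (`|x|^-1 *: x) => //=; rewrite normrZ normfV normr_id mulVf// gt_eqF.
by rewrite pairingZr normrM normfV normr_id mulrC ler_pdivrMr.
Qed.

Lemma dual_norm_le (xi : 'rV[R]_n) (c : R) :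
  (forall x : X, `|x| <= 1 -> `|pairing xi x| <= c) -> dual_norm nu xi <= c.
Proof.
move=> h; apply: ge_sup; first exact: (has_sup_dual_norm xi).1.
by move=> _ [x /= x1 <-]; exact: h.
Qed.

End FiniteDimension.

(** * Inequalities for real powers *)

Section RealPowers.
Variable R : realType.
Implicit Types a b p r : R.

Lemma normrZ_gt0 (V : normedModType R) a (x : V) : 0 < a -> `|a *: x| = a * `|x|.
Proof. by move=> a0; rewrite normrZ gtr0_norm. Qed.

Lemma eq_ler a b : a = b -> a <= b. Proof. by move->. Qed.

Lemma powR_continuous p : 0 < p -> continuous (fun x : R => `|x| `^ p).
Proof.
move=> p0 x; have [->|x0] := eqVneq x 0; last first.
  apply: (@continuous_comp _ _ _ (fun x : R => `|x|) (fun x => x `^ p)).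
    exact: norm_continuous.
  apply/differentiable_continuous/derivable1_diffP/derivable_powR.
  by rewrite in_itv/= andbT normr_gt0.
apply/cvgrPdist_lt => e e0; near=> z.
rewrite normr0 powR0 ?gt_eqF// sub0r normrN ger0_norm ?powR_ge0//.
rewrite (_ : e = (e `^ p^-1) `^ p); last first.
  by rewrite -powRrM mulVf ?gt_eqF// powRr1// ltW.
apply: gt0_ltr_powR => //; rewrite ?nnegrE ?powR_ge0//.
rewrite -normrN -sub0r; near: z.
by apply: (cvgr_dist_lt id) => //; exact: powR_gt0.
Unshelve. all: by end_near. Qed.

(* Young's inequality for [a] and [b `^ (r - 1)]. *)
Lemma powR_tangent r a b : 1 < r -> 0 <= a -> 0 <= b ->
  b `^ r + r * b `^ (r - 1) * (a - b) <= a `^ r.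
Proof.
move=> r1 a0 b0; have r0 : 0 < r by exact: lt_trans r1.
have r10 : 0 < r - 1 by rewrite subr_gt0.
have q0 : 0 < r / (r - 1) by exact: divr_gt0.
have pq : r^-1 + (r / (r - 1))^-1 = 1.
  by field; rewrite !gt_eqF.
have := conjugate_powR a0 (powR_ge0 b (r - 1)) r0 q0 pq.
rewrite -powRrM (_ : (r - 1) * (r / (r - 1)) = r); last first.
  by field; rewrite gt_eqF.
rewrite -[b `^ r](mulr_powRB1 b0 r0); set c := b `^ (r - 1).
rewrite -(ler_pM2r r0) mulrDl mulfVK ?gt_eqF//.
rewrite (_ : b * c / (r / (r - 1)) * r = b * c * (r - 1)); first lra.
by field; rewrite !gt_eqF.
Qed.

(** Adds the tangent inequalities at the midpoint [m], whose linear terms cancel. *)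
Lemma powR_midpoint r a b : 1 < r -> 0 <= a -> 0 <= b ->
  (2^-1 * (a + b)) `^ r <= 2^-1 * (a `^ r + b `^ r).
Proof.
move=> r1 a0 b0; set m := 2^-1 * _.
have m0 : 0 <= m by rewrite /m; lra.
have := powR_tangent r1 a0 m0; have := powR_tangent r1 b0 m0.
move: (m `^ (r - 1)) => c; move: (m `^ r) (a `^ r) (b `^ r) => M A B.
by rewrite (_ : b - m = - (a - m)); [lra|rewrite /m; lra].
Qed.

(** Serves at the stopping step, with [d] the noise level and [a], [b] the residuals before and
    after it: there [d] may exceed [b]. *)
Lemma powR_mulB_le r a b d : 1 < r -> 0 <= d <= a -> 0 <= b <= a ->
  b `^ (r - 1) * (d - b) <= a `^ r.
Proof.
move=> r1 /andP[d0 da] /andP[b0 ba]; have a0 : 0 <= a by exact: le_trans da.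
rewrite -(mulr_powRB1 a0 (lt_trans ltr01 r1)) mulrC.
apply: (@le_trans _ _ (d * b `^ (r - 1))).
  by rewrite ler_wpM2r ?powR_ge0// gerBl.
apply: ler_pM; rewrite ?powR_ge0//.
by apply: ge0_ler_powR; rewrite ?nnegrE// subr_ge0 ltW.
Qed.

End RealPowers.

(** * Smoothness of the norm and the duality map *)

Section DualityMap.
Variables (R : realType) (n : nat) (nu : vnorm R n).
Local Notation Y := (normed_rV nu).
Hypothesis hY : uniformly_smooth Y.

(** Rescaling [y] and [v] to unit vectors turns [t] into [s = t |v| / |y|], and for small [s] the
    modulus at [s] is at most a small multiple of [s]. *)
Lemma uniformly_smooth_norm (y v : Y) (e : R) : y != 0 -> 0 < e ->
  exists2 t0, 0 < t0 & forall t, 0 < t < t0 ->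
    `|y + t *: v| + `|y - t *: v| <= 2 * `|y| + e * t.
Proof.
move=> y0 e0; have ny0 : 0 < `|y| by rewrite normr_gt0.
have [->|v0] := eqVneq v 0.
  exists 1 => // t /andP[t0 _]; rewrite scaler0 subr0 addr0.
  have := mulr_gt0 e0 t0; lra.
have nv0 : 0 < `|v| by rewrite normr_gt0.
have e1 : 0 < e / (2 * `|v|) by rewrite divr_gt0// mulr_gt0.
have [d /= d0 hd] := @cvgr_dist_le _ _ _ _ _ _ _ hY _ e1.
exists (d * `|y| / `|v|); first by rewrite divr_gt0// mulr_gt0.
move=> t /andP[t0 td]; pose s := t * `|v| / `|y|.
have s0 : 0 < s by rewrite divr_gt0// mulr_gt0.
have sd : s < d by rewrite /s ltr_pdivrMr// -ltr_pdivlMr.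
have := hd s; rewrite /= sub0r normrN gtr0_norm// => /(_ sd s0).
rewrite sub0r normrN => /(le_trans (ler_norm _)).
rewrite ler_pdivrMr// => hs.
pose y' := `|y|^-1 *: y; pose v' := `|v|^-1 *: v.
have y'1 : `|y'| = 1 by rewrite normrZ normfV normr_id mulVf// gt_eqF.
have v'1 : `|v'| = 1 by rewrite normrZ normfV normr_id mulVf// gt_eqF.
have yE : y = `|y| *: y' by rewrite scalerA divff ?scale1r// gt_eqF.
have vE : t *: v = `|y| *: (s *: v').
  rewrite !scalerA; congr (_ *: _); rewrite /s; field; rewrite !gt_eqF//.
have : 2^-1 * (`|y' + s *: v'| + `|y' - s *: v'|) - 1 <= e / (2 * `|v|) * s.
  apply: le_trans hs; apply: ub_le_sup; last by exists (y', v').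
  exists s => _ [[p q] /= [p1 q1] <-].
  have := ler_normD p (s *: q); have := ler_normD p (- (s *: q)).
  rewrite normrN normrZ p1 q1 (gtr0_norm s0); lra.
rewrite {1 2}yE vE -scalerDr -scalerBr !normrZ normr_id.
rewrite (_ : e / (2 * `|v|) * s = e * t / (2 * `|y|)); last first.
  by rewrite /s; field; rewrite !gt_eqF.
rewrite ler_pdivlMr ?mulr_gt0//; lra.
Qed.

(* The one-sided directional derivative of the norm at [y] is sublinear, and
   smoothness makes it odd, hence linear. *)
Let dnorm (y v : Y) := inf [set (`|y + t *: v| - `|y|) / t | t in [set t : R | 0 < t]].

Let dnorm_le (y v : Y) (t : R) : 0 < t -> dnorm y v <= (`|y + t *: v| - `|y|) / t.
Proof.
move=> t0; apply: ge_inf; last by exists t.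
exists (- `|v|) => _ [s /= s0 <-].
rewrite ler_pdivlMr// mulNr lerNl opprB lerBlDr.
by rewrite -{1}(addrK (s *: v) y) (le_trans (ler_normB _ _))// normrZ_gt0// addrC mulrC.
Qed.

Let le_dnorm (y v : Y) (c : R) :
  (forall t : R, 0 < t -> c <= (`|y + t *: v| - `|y|) / t) -> c <= dnorm y v.
Proof.
move=> h; apply: lb_le_inf; last by move=> _ [t /= t0 <-]; exact: h.
by exists ((`|y + 1 *: v| - `|y|) / 1), 1 => /=.
Qed.

(** For step sizes [s] and [t], take [u = s t / (s + t)]: then [y + u (v + w)] is the convex
    combination of [y + s v] and [y + t w] with weights [t / (s + t)] and [s / (s + t)], so its
    difference quotient is at most the sum of the two others. *)
Let dnormD_le (y v w : Y) : dnorm y (v + w) <= dnorm y v + dnorm y w.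
Proof.
rewrite -lerBlDr; apply: le_dnorm => s s0.
rewrite lerBlDr -lerBlDl.
apply: le_dnorm => t t0; rewrite lerBlDl.
have st0 : 0 < s + t by exact: addr_gt0.
have u0 : 0 < s * t / (s + t) by rewrite divr_gt0// mulr_gt0.
apply: le_trans (dnorm_le _ _ u0) _; rewrite ler_pdivrMr//.
have -> : y + (s * t / (s + t)) *: (v + w) =
    (t / (s + t)) *: (y + s *: v) + (s / (s + t)) *: (y + t *: w).
  rewrite !scalerDr !scalerA addrACA -scalerDl.
  rewrite -{1}(scale1r y).
  by congr (_ *: _ + (_ *: _ + _ *: _)); field; rewrite gt_eqF.
rewrite lerBlDr (le_trans (ler_normD _ _))// !normrZ_gt0 ?divr_gt0//.
by apply/eq_ler; field; rewrite !gt_eqF.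
Qed.

Let dnormZ_le (y v : Y) (a : R) : 0 < a -> dnorm y (a *: v) <= a * dnorm y v.
Proof.
move=> a0; rewrite -ler_pdivrMl//; apply: le_dnorm => t t0.
rewrite ler_pdivrMl// (le_trans (dnorm_le _ _ (divr_gt0 t0 a0)))//.
rewrite scalerA mulfVK ?gt_eqF// ; apply/eq_ler; field; rewrite !gt_eqF//.
Qed.

Let dnormZ_gt0 (y v : Y) (a : R) : 0 < a -> dnorm y (a *: v) = a * dnorm y v.
Proof.
move=> a0; apply/le_anti; rewrite dnormZ_le//= -ler_pdivlMl//.
rewrite -{1}(scale1r v) -(mulVf (lt0r_neq0 a0)) -scalerA dnormZ_le//.
by rewrite invr_gt0.
Qed.

Let dnorm0 (y : Y) : dnorm y 0 = 0.
Proof.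
apply/le_anti/andP; split.
  by have := dnorm_le y 0 ltr01; rewrite scaler0 addr0 subrr mul0r.
by apply: le_dnorm => t _; rewrite scaler0 addr0 subrr mul0r.
Qed.

(** Subadditivity gives one inequality. Smoothness gives the other: the quotients for [v] and [- v]
    at a common small step add up to at most [e]. *)
Let dnormN (y v : Y) : y != 0 -> dnorm y (- v) = - dnorm y v.
Proof.
move=> y0; apply/eqP; rewrite -addr_eq0 eq_le; apply/andP; split; last first.
  by rewrite -(dnorm0 y) -(addNr v) dnormD_le.
apply/ler_addgt0Pl => e e0; rewrite addr0.
have [t0 t00 ht] := uniformly_smooth_norm v y0 e0.
have t20 : 0 < t0 / 2 by rewrite divr_gt0.
have /ht : 0 < t0 / 2 < t0 by rewrite t20/= ltr_pdivrMr// ltr_pMr// ltr1n.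
have := dnorm_le y v t20; have := dnorm_le y (- v) t20.
move: (t0 / 2) t20 => t tp; rewrite scalerN !ler_pdivlMr// => h1 h2 h3.
by rewrite -(ler_pM2r tp); lra.
Qed.

(** The functional is the gradient [dnorm y] of the norm. In the direction [y] the difference
    quotient is constantly [|y|]; in a direction [x] the quotient at step 1 is at most [|x|]. *)
Lemma norming_functional (y : Y) : y != 0 ->
  exists2 e, pairing e y = `|y| & forall x : Y, pairing e x <= `|x|.
Proof.
move=> y0.
have dD v w : dnorm y (v + w) = dnorm y v + dnorm y w.
  apply/le_anti; rewrite dnormD_le/= -lerBrDr -dnormN//.
  by rewrite -{1}(addrK w v) dnormD_le.
have dZ a v : dnorm y (a *: v) = a * dnorm y v.
  have [a0|a0|->] := ltgtP a 0; last by rewrite scale0r mul0r dnorm0.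
    rewrite -[a]opprK scaleNr dnormN// dnormZ_gt0 ?mulNr//.
    by rewrite oppr_gt0.
  exact: dnormZ_gt0.
have dE x : pairing (\row_i dnorm y (delta_mx 0 i : 'rV_n)) x = dnorm y x.
  rewrite [in RHS](row_sum_delta x).
  rewrite (big_morph (dnorm y) dD (dnorm0 y)); apply: eq_bigr => i _.
  by rewrite dZ mxE mulrC.
exists (\row_i dnorm y (delta_mx 0 i : 'rV_n)).
  have q t : 0 < t -> (`|y + t *: y| - `|y|) / t = `|y|.
    move=> t0; rewrite -{1}(scale1r y) -scalerDl normrZ_gt0 ?addr_gt0//.
    by field; rewrite gt_eqF.
  rewrite dE; apply/le_anti; rewrite -{1}(q 1 ltr01) dnorm_le//=.
  by apply: le_dnorm => t t0; rewrite q.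
move=> x; rewrite dE (le_trans (dnorm_le _ _ ltr01))// divr1 scale1r.
by rewrite lerBlDl ler_normD.
Qed.

(** [xi] bounds [|y - t v|] from below, and smoothness turns this into an upper bound for
    [|y + t v|]. *)
Lemma norm_expansion (y v : Y) (xi : 'rV[R]_n) (e : R) :
  y != 0 -> pairing xi y = `|y| -> (forall x : Y, pairing xi x <= `|x|) ->
  0 < e -> exists2 t0, 0 < t0 & forall t, 0 < t < t0 ->
    `|y + t *: v| <= `|y| + t * (pairing xi v + e).
Proof.
move=> y0 xiy xile e0; have [t0 t00 ht] := uniformly_smooth_norm v y0 e0.
exists t0 => // t /ht; have := xile (y - t *: v).
by rewrite pairingDr pairingNr pairingZr xiy; lra.
Qed.

(** One functional bounds [|y + t v|] from below and the other expands it from above, so at every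
    [v] one is at most the other; the roles are symmetric. *)
Lemma norming_functional_unique (y : Y) (xi eta : 'rV[R]_n) : y != 0 ->
  pairing xi y = `|y| -> (forall x : Y, pairing xi x <= `|x|) ->
  pairing eta y = `|y| -> (forall x : Y, pairing eta x <= `|x|) -> xi = eta.
Proof.
move=> y0 h1 h2 h3 h4.
suff le (a b : 'rV[R]_n) : pairing a y = `|y| ->
    (forall x : Y, pairing a x <= `|x|) ->
    pairing b y = `|y| -> (forall x : Y, pairing b x <= `|x|) ->
    forall v, pairing b v <= pairing a v.
  apply/rowP => i; rewrite -!pairing_delta; apply/le_anti.
  by rewrite le// le.
move=> ay al bY bl v; apply/ler_addgt0Pl => e e0.
have [t0 t00 ht] := norm_expansion v y0 ay al e0.
have t20 : 0 < t0 / 2 by rewrite divr_gt0.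
have /ht : 0 < t0 / 2 < t0 by rewrite t20/= ltr_pdivrMr// ltr_pMr// ltr1n.
have := bl (y + (t0 / 2) *: v).
rewrite pairingDr pairingZr bY => h5 h6.
by rewrite -(ler_pM2l t20); lra.
Qed.

Variable r : R.
Hypothesis r1 : 1 < r.
Let r0 : 0 < r. Proof. exact: lt_trans r1. Qed.
Let r10 : 0 < r - 1. Proof. by rewrite subr_gt0. Qed.

Lemma duality_map_le (y : Y) (eta : 'rV[R]_n) (x : Y) :
  duality_map r y eta -> pairing eta x <= `|y| `^ (r - 1) * `|x|.
Proof. by move=> [<- _]; exact: le_trans (ler_norm _) (ler_pairing _ _). Qed.

Lemma duality_map0 (eta : 'rV[R]_n) : duality_map r (0 : Y) eta -> eta = 0.
Proof.
move=> h; apply/rowP => i; rewrite mxE -pairing_delta; apply/le_anti/andP; split.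
  have := duality_map_le (delta_mx 0 i : 'rV_n) h.
  by rewrite normr0 powR0 ?gt_eqF// mul0r.
have := duality_map_le (- delta_mx 0 i : 'rV_n) h.
by rewrite normr0 powR0 ?gt_eqF// mul0r pairingNr oppr_le0.
Qed.

Lemma duality_map_norming (y : Y) (eta : 'rV[R]_n) : y != 0 ->
  duality_map r y eta ->
  exists xi, [/\ eta = `|y| `^ (r - 1) *: xi, pairing xi y = `|y| &
    forall x : Y, pairing xi x <= `|x|].
Proof.
move=> y0 h; have ny0 : 0 < `|y| by rewrite normr_gt0.
have p0 : 0 < `|y| `^ (r - 1) by exact: powR_gt0.
exists ((`|y| `^ (r - 1))^-1 *: eta); split.
- by rewrite scalerA divff ?scale1r// gt_eqF.
- by rewrite pairingZl h.2 -(mulr_powRB1 (ltW ny0) r0) mulrC mulfK ?gt_eqF.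
- by move=> x; rewrite pairingZl ler_pdivrMl// duality_map_le.
Qed.

(** For [y != 0] the elements are the norming functionals of [y] scaled by the power [r - 1] of
    [|y|]; at 0 this power vanishes because [r > 1]. *)
Lemma duality_map_singleton (y : Y) : exists! eta, duality_map r y eta.
Proof.
have [->|y0] := eqVneq y 0.
  exists 0; split; last by move=> eta /duality_map0.
  split; last by rewrite pairing0l normr0 powR0 ?gt_eqF.
  rewrite normr0 powR0 ?gt_eqF//; apply/le_anti/andP; split.
    by apply: dual_norm_le => x _; rewrite pairing0l normr0.
  apply: ub_le_sup; first exact: (has_sup_dual_norm nu 0).2.
  by exists 0; rewrite /= ?normr0// pairing0l normr0.
have ny0 : 0 < `|y| by rewrite normr_gt0.
have [xi xiy xile] := norming_functional y0.
have p0 : 0 < `|y| `^ (r - 1) by exact: powR_gt0.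
exists (`|y| `^ (r - 1) *: xi); split; last first.
  move=> eta /(duality_map_norming y0)[xi' [-> h1 h2]]; congr (_ *: _).
  exact: norming_functional_unique xile h1 h2.
have E : pairing (`|y| `^ (r - 1) *: xi) y = `|y| `^ r.
  by rewrite pairingZl xiy -(mulr_powRB1 (ltW ny0) r0) mulrC.
split=> //; apply/le_anti/andP; split.
  apply: dual_norm_le => x x1; rewrite pairingZl normrM gtr0_norm//.
  rewrite -[leRHS]mulr1 ler_pM2l// ler_norml.
  rewrite (le_trans (xile x) x1) andbT lerNl -pairingNr.
  by rewrite (le_trans (xile _))// normrN.
have := le_trans (ler_norm _) (ler_pairing (`|y| `^ (r - 1) *: xi) y).
by rewrite E -(mulr_powRB1 (ltW ny0) r0) mulrC ler_pM2r.
Qed.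

(* [J_r] is the gradient of the [r]-th power of the norm divided by [r]; only
   the upper estimate is needed. *)
Lemma duality_map_expansion (y v : Y) (eta : 'rV[R]_n) (e : R) :
  duality_map r y eta -> 0 < e ->
  exists2 t0, 0 < t0 & forall t, 0 < t < t0 ->
    `|y + t *: v| `^ r <= `|y| `^ r + r * t * (pairing eta v + e).
Proof.
move=> h e0.
(* A bound [p] on the slope of the norm suffices: [powR_tangent] at [|y + t v|] bounds the increase
   of the power, with a factor that is continuous in [t], so the strict inequality persists for
   small [t]. *)
suff : exists p, [/\ `|y| `^ (r - 1) * p < pairing eta v + e &
    exists2 t0, 0 < t0 & forall t, 0 < t < t0 ->
      `|y + t *: v| <= `|y| + t * p].
  move=> [p [pe [t1 t10 ht]]].
  have cg : `| `|y + t *: v| | `^ (r - 1) * p @[t --> (0 : R)] -->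
      `| `|y + 0 *: v| | `^ (r - 1) * p.
    apply: cvgMl; apply: (@continuous_comp _ _ _
      (fun t : R => `|y + t *: v|) (fun x : R => `|x| `^ (r - 1))); last first.
      exact: powR_continuous.
    apply: cvg_norm; apply: cvgD; first exact: cvg_cst.
    by apply: cvgZr_tmp; exact: cvg_id.
  rewrite scale0r addr0 normr_id in cg.
  have [d /= d0 hd] := cvgr_lt _ cg _ pe.
  exists (Num.min t1 d); first by rewrite lt_min t10.
  move=> t /andP[t0]; rewrite lt_min => /andP[tt1 td].
  have /hd : ball_ [eta Num.norm] 0 d t by rewrite /= sub0r normrN gtr0_norm.
  rewrite normr_id => {}hd.
  have := ht t; rewrite t0 tt1 => /(_ isT) {}ht.
  have := powR_tangent r1 (normr_ge0 y) (normr_ge0 (y + t *: v)).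
  move: hd ht (powR_ge0 `|y + t *: v| (r - 1)).
  move: (_ `^ (r - 1)) (`|y + t *: v| `^ r) => B B' hd ht B0 hB.
  have h1 : r * (B * (`|y + t *: v| - `|y|)) <= r * (B * (t * p)).
    by rewrite ler_pM2l// ler_wpM2l// lerBlDl.
  have h2 : r * t * (B * p) <= r * t * (pairing eta v + e).
    by rewrite ler_pM2l ?mulr_gt0// ltW.
  by lra.
have [y0|y0] := eqVneq y 0.
  exists `|v|; split.
    rewrite y0 normr0 powR0 ?gt_eqF// mul0r; move: h.
    by rewrite y0 => /duality_map0 ->; rewrite pairing0l add0r.
  exists 1 => // t /andP[t0 _].
  by rewrite y0 normr0 !add0r normrZ_gt0.
have [xi [-> h1 h2]] := duality_map_norming y0 h.
have p0 : 0 < `|y| `^ (r - 1) by rewrite powR_gt0// normr_gt0.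
have e1 : 0 < e / (2 * `|y| `^ (r - 1)) by rewrite divr_gt0// mulr_gt0.
exists (pairing xi v + e / (2 * `|y| `^ (r - 1))); split.
  rewrite mulrDr pairingZl ltrD2l.
  rewrite (_ : _ * (_ / _) = e / 2); first by rewrite ltr_pdivrMr// ltr_pMr// ltr1n.
  by field; rewrite gt_eqF.
exact: norm_expansion.
Qed.

End DualityMap.

(** * Uniform convexity and growth of Bregman distances *)

Section UniformConvexity.
Variables (R : realType) (N : nat) (nu : vnorm R N).
Local Notation X := (normed_rV nu).
Variable Phi : X -> R.
Hypothesis huc : uniformly_convex Phi.

Lemma uniformly_convex_le (t : R) (x x' : X) : 0 <= t <= 1 ->
  Phi (t *: x + (1 - t) *: x') <= t * Phi x + (1 - t) * Phi x'.
Proof.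
move=> t01; have [h [h0 _ /(_ t x x' t01)]] := huc.
rewrite -lee_fin; apply: le_trans; rewrite leeDl//.
apply: mule_ge0; last exact: h0.
by rewrite lee_fin; case/andP: t01 => t0 t1; rewrite mulr_ge0// subr_ge0.
Qed.

(** Extracts from the extended-valued modulus a finite positive gain at distance [e]; the
    coefficient [t (1 - t)] is [1 / 4] at the midpoint. *)
Lemma uniformly_convex_midpoint (e : R) : 0 < e ->
  exists2 k, 0 < k & forall x x' : X, `|x - x'| = e ->
    Phi (2^-1 *: x + 2^-1 *: x') + k <= 2^-1 * (Phi x + Phi x').
Proof.
move=> e0; have [h [h0 h1 h2]] := huc.
have he0 : (0 < h e)%E.
  rewrite lt_def (h0 _ (ltW e0)) andbT; apply/eqP => /(h1 _ (ltW e0)) E.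
  by move: e0; rewrite E ltxx.
have half : 0 <= (2^-1 : R) <= 1 by apply/andP; split; lra.
have E2 : 1 - 2^-1 = 2^-1 :> R by lra.
case E : (h e) he0 => [c||]//; rewrite ?lte_fin => c0.
  exists (4^-1 * c); first lra.
  move=> x x' xe; have := h2 _ x x' half.
  by rewrite xe E E2 -EFinM -EFinD lee_fin; lra.
(* If [h e] is infinite, no two points are at distance [e], and any constant works. *)
exists 1 => // x x' xe; have := h2 _ x x' half.
by rewrite xe E E2 gt0_muley ?lte_fin; last lra.
Qed.

Lemma bregmanxx (xi : 'rV[R]_N) (x : X) : bregman Phi xi x x = 0.
Proof. by rewrite /bregman !subrr pairing0r subrr. Qed.

Lemma bregman_le (xi : 'rV[R]_N) (t : R) (x z x' : X) : 0 <= t <= 1 ->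
  bregman Phi xi (t *: x + (1 - t) *: z) x' <=
  t * bregman Phi xi x x' + (1 - t) * bregman Phi xi z x'.
Proof.
move=> t01; have := uniformly_convex_le x z t01.
rewrite /bregman !pairingDr !pairingZr pairingNr; lra.
Qed.

Lemma bregman_midpoint_lt (xi : 'rV[R]_N) (x z x' : X) : x != z ->
  bregman Phi xi (2^-1 *: x + 2^-1 *: z) x' <
  2^-1 * (bregman Phi xi x x' + bregman Phi xi z x').
Proof.
rewrite -subr_eq0 -normr_gt0 => xz0.
have [k k0 /(_ x z erefl)] := uniformly_convex_midpoint xz0.
rewrite /bregman !pairingDr !pairingZr pairingNr; lra.
Qed.

(* Convexity along the segment from [x'] to [x] makes the lower bound at
   distance [e] grow linearly. *)
Lemma bregman_ge_norm (e : R) : 0 < e ->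
  exists2 k, 0 < k & forall (xi : 'rV[R]_N) (x x' : X),
    subdifferential Phi x' xi -> e <= `|x - x'| ->
    k * `|x - x'| <= bregman Phi xi x x'.
Proof.
move=> e0; have [k k0 hk] := uniformly_convex_midpoint e0.
exists (2 * k / e); first by rewrite divr_gt0// mulr_gt0.
move=> xi x x' sx ex; set d := `|x - x'| in ex *.
have d0 : 0 < d by exact: lt_le_trans ex.
pose t := e / d; pose z := t *: x + (1 - t) *: x'.
have t0 : 0 < t by exact: divr_gt0.
have t1 : t <= 1 by rewrite ler_pdivrMr// mul1r.
have zx : z - x' = t *: (x - x').
  by rewrite /z scalerBl scale1r scalerBr addrA addrAC addrK.
have nzx : `|z - x'| = e by rewrite zx normrZ_gt0// divfK// gt_eqF.
have h1 : bregman Phi xi z x' <= t * bregman Phi xi x x'.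
  have := @bregman_le xi t x x' x'; rewrite bregmanxx mulr0 addr0; apply.
  by rewrite (ltW t0).
have h2 : 2 * k <= bregman Phi xi z x'.
  have := hk z x' nzx; have := sx (2^-1 *: z + 2^-1 *: x').
  have -> : 2^-1 *: z + 2^-1 *: x' - x' = 2^-1 *: (z - x').
    rewrite scalerBr -addrA; congr (_ + _).
    by rewrite -{2}(scale1r x') -scalerBl -scaleNr; congr (_ *: _); lra.
  rewrite pairingZr /bregman; lra.
have -> : 2 * k / e * d = d / e * (2 * k) by field; rewrite gt_eqF.
by rewrite -ler_pdivlMl ?divr_gt0// invf_div; exact: le_trans h2 h1.
Qed.

(** Beyond distance 1 from [x'], [bregman_ge_norm] gives linear growth. *)
Lemma bregman_coercive (xi : 'rV[R]_N) (x' : X) (c : R) :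
  subdifferential Phi x' xi ->
  exists B, forall x, bregman Phi xi x x' <= c -> `|x| <= B.
Proof.
move=> sx; have [k k0 hk] := bregman_ge_norm (ltr01 : 0 < 1 :> R).
exists (`|x'| + (1 + `|c| / k)) => x xc.
rewrite -{1}(subrK x' x) addrC (le_trans (ler_normD _ _))// lerD2l.
have [x1|/ltW x1] := leP 1 `|x - x'|; last first.
  by rewrite (le_trans x1)// lerDl divr_ge0// ltW.
have := le_trans (hk _ _ _ sx x1) (le_trans xc (ler_norm c)).
by rewrite mulrC -ler_pdivlMr// => /le_trans; apply; rewrite lerDr.
Qed.

Hypothesis hcont : continuous Phi.

Lemma bregman_continuous (xi : 'rV[R]_N) (x' : X) :
  continuous (fun x => bregman Phi xi x x').
Proof.
move=> x; pose G := nbhs (x : X).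
apply: (@cvgB _ _ _ G _ (fun x => Phi x - Phi x') (fun x => pairing xi (x - x'))).
  by apply: (@cvgB _ _ _ G _ Phi (fun=> Phi x')); [exact: hcont|exact: cvg_cst].
apply: (@continuous_comp _ _ _ (fun x : X => x - x') (pairing xi)).
  by apply: (@cvgB _ _ _ G _ id (fun=> x')); [exact: cvg_id|exact: cvg_cst].
exact: pairing_continuous.
Qed.

End UniformConvexity.

(** * One step: the minimizer and its optimality condition *)

Section TikhonovStep.
Variables (R : realType) (N M : nat) (nuX : vnorm R N) (nuY : vnorm R M).
Local Notation X := (normed_rV nuX).
Local Notation Y := (normed_rV nuY).
Variables (F : {linear X -> Y}) (Phi : X -> R).
Hypothesis hY : uniformly_smooth Y.
Hypothesis hcont : continuous Phi.
Hypothesis huc : uniformly_convex Phi.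
Variables (r : R).
Hypothesis r1 : 1 < r.
Let r0 : 0 < r. Proof. exact: lt_trans r1. Qed.

Lemma pairing_transpose_op (eta : 'rV[R]_M) (x : X) :
  pairing (transpose_op F eta) x = pairing eta (F x).
Proof.
pose f : {linear 'rV[R]_N -> 'rV[R]_M} := F.
have -> : F x = (x : 'rV_N) *m lin1_mx f by rewrite mul_rV_lin1.
by rewrite !pairing_mulmx trmx_mul mulmxA.
Qed.

Lemma residual_continuous (z : Y) : continuous (fun x : X => `|F x - z|).
Proof.
move=> x; pose G := nbhs (x : X).
apply: (@cvg_norm _ _ _ G); apply: (@cvgB _ _ _ G _ F (fun=> z)).
  exact: linear_continuous_rV.
exact: cvg_cst.
Qed.

Section Step.
Variables (yd : Y) (a : R) (x' : X) (xi : 'rV[R]_N).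
Hypothesis a0 : 0 < a.
Hypothesis sx : subdifferential Phi x' xi.
Local Notation T := (inett_functional F Phi r yd a (x', xi)).

(** Existence comes from coercivity of the Bregman term; uniqueness from its strict convexity at the
    midpoint, together with convexity of the data term. *)
Lemma inett_functional_argmin : exists! x, argmin T x.
Proof.
have cT : continuous T.
  move=> x; pose G := nbhs (x : X).
  apply: (@cvgD _ _ _ G _ (fun x => r^-1 * `|F x - yd| `^ r)
    (fun x => a * bregman Phi xi x x')).
    apply: (@cvgMr _ _ G); rewrite -(normr_id (F x - yd)).
    under eq_fun do rewrite -(normr_id (F _ - yd)).
    apply: (@continuous_comp _ _ _ (fun x => `|F x - yd|)
      (fun t : R => `|t| `^ r)); first exact: residual_continuous.
    exact: powR_continuous.
  by apply: (@cvgMr _ _ G); exact: bregman_continuous.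
(* Where [T] is at most [T x'], so is its Bregman term, which carries the factor [a]. *)
have [B hB] := bregman_coercive huc (T x' / a) sx.
have [||||m _ hm] := @coercive_min _ _ _ setT T x' B.
- exact: closedT.
- exact: cT.
- by [].
- move=> x _ xT; apply: hB; rewrite ler_pdivlMr// mulrC (le_trans _ xT)//.
  by rewrite /inett_functional lerDr mulr_ge0 ?powR_ge0// invr_ge0 ltW.
exists m; split; first by move=> x; exact: hm.
move=> z hz; apply/eqP; apply: contraT => mz.
have Emz : T m = T z by apply/le_anti; rewrite hm// hz.
have := bregman_midpoint_lt huc xi x' mz.
have := hm (2^-1 *: m + 2^-1 *: z) I.
rewrite {1}Emz in hm *.
have Fmid : F (2^-1 *: m + 2^-1 *: z) - yd =
    2^-1 *: (F m - yd) + 2^-1 *: (F z - yd).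
  rewrite linearD !linearZ/= !scalerBr addrACA; congr (_ + _).
  by rewrite -opprD -scalerDl (_ : 2^-1 + 2^-1 = 1 :> R) ?scale1r//; lra.
have h3 : `|F (2^-1 *: m + 2^-1 *: z) - yd| `^ r <=
    2^-1 * (`|F m - yd| `^ r + `|F z - yd| `^ r).
  apply: le_trans (powR_midpoint r1 (normr_ge0 _) (normr_ge0 _)).
  have nn : 0 <= 2^-1 * (`|F m - yd| + `|F z - yd|).
    by have := normr_ge0 (F m - yd); have := normr_ge0 (F z - yd); lra.
  apply: (ge0_ler_powR (ltW r0)); rewrite ?nnegrE//.
  by rewrite Fmid (le_trans (ler_normD _ _))// !normrZ_gt0// mulrDr.
move=> h1 h2.
have h4 : r^-1 * `|F (2^-1 *: m + 2^-1 *: z) - yd| `^ r <=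
    r^-1 * (2^-1 * (`|F m - yd| `^ r + `|F z - yd| `^ r)).
  by rewrite ler_pM2l// invr_gt0.
move: h2; rewrite -(ltr_pM2l a0) => h2.
by move: Emz h1; rewrite /inett_functional/= => h5 h6; exfalso; clear Fmid; lra.
Qed.

(** The minimizer [x] is compared with [x + t (z - x)]: the data term is expanded to first order,
    the Bregman term is bounded by convexity, and dividing by [t] gives the subgradient inequality
    up to [e]. *)
Lemma argmin_subdifferential (x : X) (eta : 'rV[R]_M) :
  argmin T x -> duality_map r (F x - yd) eta ->
  subdifferential Phi x (xi - a^-1 *: transpose_op F eta).
Proof.
move=> hx heta z; rewrite pairingDl pairingNl pairingZl pairing_transpose_op.
set v := F (z - x); set d := Phi z - Phi x - pairing xi (z - x).
suff : 0 <= pairing eta v + a * d.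
  move=> h; have -> : Phi z - Phi x - (pairing xi (z - x) - a^-1 * pairing eta v) =
      a^-1 * (pairing eta v + a * d) by rewrite /d; field; rewrite gt_eqF.
  by rewrite mulr_ge0// invr_ge0 ltW.
apply/ler_addgt0Pl => e e0; rewrite addrC.
have [t0 t00 ht] := duality_map_expansion hY r1 v heta e0.
pose t := Num.min t0 1 / 2.
have m0 : 0 < Num.min t0 1 by rewrite lt_min t00 ltr01.
have tp : 0 < t by rewrite divr_gt0.
have tm : t < Num.min t0 1 by rewrite ltr_pdivrMr// ltr_pMr// ltr1n.
have /ht {}ht : 0 < t < t0 by rewrite tp (lt_le_trans tm)// ge_min lexx.
have t1 : t <= 1 by rewrite ltW// (lt_le_trans tm)// ge_min lexx orbT.
have zE : t *: z + (1 - t) *: x = x + t *: (z - x).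
  by rewrite scalerBl scale1r scalerBr addrCA.
have t01 : 0 <= t <= 1 by rewrite (ltW tp).
have h1 := bregman_le huc xi z x x' t01.
have := hx (t *: z + (1 - t) *: x).
have FE : F (t *: z + (1 - t) *: x) - yd = (F x - yd) + t *: v.
  by rewrite zE linearD linearZ/= addrAC.
rewrite /inett_functional /= FE => h2; clear FE zE.
have h3 : r^-1 * `|F x - yd + t *: v| `^ r <=
    r^-1 * `|F x - yd| `^ r + t * (pairing eta v + e).
  rewrite -(ler_pM2l r0) mulrDr !mulrA mulfV ?gt_eqF// !mul1r.
  by rewrite mulrA in ht.
have h4 : a * bregman Phi xi (t *: z + (1 - t) *: x) x' <=
    a * bregman Phi xi x x' + t * (a * d).
  move: h1; rewrite -(ler_pM2l a0) /d /bregman !pairingDr !pairingNr; lra.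
by rewrite -(pmulr_rge0 _ tp); lra.
Qed.

End Step.
End TikhonovStep.

(** * The iteration for a fixed datum: well-posedness, residuals and multipliers *)

Section Iteration.
Variables (R : realType) (N M : nat) (nuX : vnorm R N) (nuY : vnorm R M).
Local Notation X := (normed_rV nuX).
Local Notation Y := (normed_rV nuY).
Variables (F : {linear X -> Y}) (Phi : X -> R).
Hypothesis hY : uniformly_smooth Y.
Hypothesis hcont : continuous Phi.
Hypothesis huc : uniformly_convex Phi.
Variables (r : R) (alpha : nat -> R) (x0 : X) (xi0 : 'rV[R]_N).
Hypothesis r1 : 1 < r.
Hypothesis hxi0 : subdifferential Phi x0 xi0.
Hypothesis alpha_gt0 : forall n, 0 < alpha n.+1.
Let r0 : 0 < r. Proof. exact: lt_trans r1. Qed.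
Let r10 : 0 <= r - 1. Proof. by rewrite subr_ge0 ltW. Qed.

Section FixedDatum.
Variable yd : Y.
Local Notation iter n := (inett F Phi r alpha x0 xi0 yd n).
Local Notation res n := `|F (iter n).1 - yd|.

Lemma inett_duality n :
  duality_map r (F (iter n.+1).1 - yd)
    (xget 0 (duality_map r (F (iter n.+1).1 - yd))).
Proof.
have [eta [heta _]] := duality_map_singleton hY r1 (F (iter n.+1).1 - yd).
by apply: xgetPex; exists eta.
Qed.

(** The subgradient premise makes the functional coercive; [inett_subdifferential] establishes it by
    induction, through this lemma. *)
Lemma inett_argmin n : subdifferential Phi (iter n).1 (iter n).2 ->
  argmin (inett_functional F Phi r yd (alpha n.+1) (iter n)) (iter n.+1).1.
Proof.
move=> sn; have [x [hx _]] :=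
  inett_functional_argmin F hcont huc r1 yd (alpha_gt0 n) sn.
by apply: xgetPex; exists x; exact: hx.
Qed.

Lemma inett_subdifferential n : subdifferential Phi (iter n).1 (iter n).2.
Proof.
elim: n => [|n IHn]; first exact: hxi0.
apply: (@argmin_subdifferential _ _ _ _ _ _ _ hY huc _ r1 _ _ (iter n).1) => //.
- exact: inett_argmin.
- exact: inett_duality.
Qed.

Lemma inett_is_well_posed : inett_well_posed F Phi r alpha x0 xi0 yd.
Proof.
split; [|move=> n|exact: inett_subdifferential].
  exact: duality_map_singleton.
have [x [hx ux]] := inett_functional_argmin F hcont huc r1 yd (alpha_gt0 n)
  (inett_subdifferential n).
by exists x; split => [|z hz]; [exact: hx|exact: ux].
Qed.

Lemma inett_dual_step n (v : X) (c : R) :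
  pairing (xget 0 (duality_map r (F (iter n.+1).1 - yd))) (F v) <= c ->
  pairing ((iter n).2 - (iter n.+1).2) v <= (alpha n.+1)^-1 * c.
Proof.
move=> h; rewrite [(iter n.+1).2]/= opprB addrC subrK pairingZl.
by rewrite pairing_transpose_op ler_pM2l// invr_gt0.
Qed.

(** The new iterate is compared with the old one, at which the Bregman term vanishes. *)
Lemma residual_nonincreasingS n : res n.+1 <= res n.
Proof.
have := inett_argmin (inett_subdifferential n) (iter n).1.
rewrite /inett_functional bregmanxx mulr0 addr0 => h.
have : r^-1 * res n.+1 `^ r <= r^-1 * res n `^ r.
  apply: le_trans h; rewrite lerDl mulr_ge0// ?(ltW (alpha_gt0 n))//.
  exact: inett_subdifferential.
rewrite ler_pM2l ?invr_gt0//; apply: contraTT; rewrite -!ltNge.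
by apply: gt0_ltr_powR; rewrite ?nnegrE.
Qed.

Lemma residual_nonincreasing m n : (m <= n)%N -> res n <= res m.
Proof.
move=> /subnK <-; elim: (n - m)%N => // k; apply: le_trans.
exact: residual_nonincreasingS.
Qed.

(* The Lagrange multipliers satisfy [zeta_n = xi0 - F^T lambda_n], and
   [weight n] bounds the dual norm of [lambda_n]. *)
Definition weight n :=
  \sum_(0 <= k < n) (alpha k.+1)^-1 * res k.+1 `^ (r - 1).

Lemma weight_ge0 n : 0 <= weight n.
Proof.
apply: sumr_ge0 => k _; rewrite mulr_ge0 ?powR_ge0//.
by rewrite invr_ge0 ltW.
Qed.

Lemma multiplier_le n (v : X) : pairing (xi0 - (iter n).2) v <= weight n * `|F v|.
Proof.
elim: n => [|n IHn]; first by rewrite /= subrr pairing0l /weight big_geq ?mul0r.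
rewrite -(subrKA (iter n).2) addrC pairingDl /weight big_nat_recr//= mulrDl addrC.
apply: lerD => //; rewrite -mulrA; apply: inett_dual_step.
exact: duality_map_le (inett_duality n).
Qed.

(** * Bregman distances from a solution to the iterates *)

Section Solution.
Variables (y : Y) (xd : X) (delta tau : R).
Hypothesis hyd : `|yd - y| <= delta.
Hypothesis hxd : F xd = y.
Hypothesis tau1 : 1 < tau.
Let tau0 : 0 < tau. Proof. exact: lt_trans tau1. Qed.
Local Notation breg n := (bregman Phi (iter n).2 xd (iter n).1).
Let kappa := 1 - tau^-1.

Lemma one_sub_inv_gt0 : 0 < 1 - tau^-1.
Proof. by rewrite subr_gt0 invf_lt1. Qed.

Lemma breg_ge0 n : 0 <= breg n.
Proof. exact: inett_subdifferential. Qed.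

Lemma exact_residual_le (n : nat) : `|F (iter n).1 - y| <= res n + delta.
Proof.
rewrite -(subrKA yd) (le_trans (ler_normD _ _))// lerD2l//.
Qed.

(** Replacing the current subgradient by [xi0] costs its difference from [xi0] paired with
    [xd - u_n], which [multiplier_le] controls through [y - F u_n]. *)
Lemma breg_multiplier n :
  breg n <= bregman Phi xi0 xd x0 - bregman Phi xi0 (iter n).1 x0 +
            weight n * (res n + delta).
Proof.
have -> : breg n = bregman Phi xi0 xd x0 - bregman Phi xi0 (iter n).1 x0 +
    pairing (xi0 - (iter n).2) (xd - (iter n).1).
  rewrite /bregman pairingDl !pairingDr !pairingNl !pairingNr; ring.
rewrite lerD2l (le_trans (multiplier_le _ _))// ler_wpM2l ?weight_ge0//.
by rewrite linearB/= hxd distrC exact_residual_le.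
Qed.

(** Three-point identity: the Bregman distance between consecutive iterates is dropped, and [J_r] is
    paired with [y - F u_(n+1)], split into noise and residual. *)
Lemma breg_step n :
  breg n.+1 <= breg n +
    (alpha n.+1)^-1 * (res n.+1 `^ (r - 1) * (delta - res n.+1)).
Proof.
have -> : breg n.+1 = breg n - bregman Phi (iter n).2 (iter n.+1).1 (iter n).1 +
    pairing ((iter n).2 - (iter n.+1).2) (xd - (iter n.+1).1).
  rewrite /bregman pairingDl !pairingDr !pairingNl !pairingNr; ring.
apply: lerD; first by rewrite gerBl; exact: inett_subdifferential.
apply: inett_dual_step; rewrite linearB/= hxd.
have -> : y - F (iter n.+1).1 = (y - yd) - (F (iter n.+1).1 - yd).
  by rewrite opprB addrA subrK.
have [_ hJ] := inett_duality n.
rewrite pairingDr pairingNr hJ mulrBr [_ * res n.+1]mulrC mulr_powRB1//.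
rewrite lerD2r (le_trans (duality_map_le _ (inett_duality n)))//.
by rewrite ler_wpM2l ?powR_ge0// distrC.
Qed.

(** Before stopping, [delta] is less than the residual divided by [tau], so the increment in
    [breg_step] is at most [- kappa] times the power term. *)
Lemma breg_drop n : tau * delta < res n.+1 ->
  kappa * ((alpha n.+1)^-1 * res n.+1 `^ r) <= breg n - breg n.+1.
Proof.
move=> h; have := breg_step n.
have : kappa * ((alpha n.+1)^-1 * res n.+1 `^ r) <=
    - ((alpha n.+1)^-1 * (res n.+1 `^ (r - 1) * (delta - res n.+1))).
  rewrite mulrCA -mulrN ler_pM2l ?invr_gt0// -mulrN opprB.
  rewrite -(mulr_powRB1 (normr_ge0 _) r0) mulrA mulrC ler_wpM2l ?powR_ge0//.
  rewrite /kappa mulrBl mul1r lerD2l lerN2 mulrC ler_pdivlMr// mulrC.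
  exact: ltW.
by move: (_ * (_ * _)) (_ * (_ * _)) => a b; lra.
Qed.

Lemma breg_sum_drop (j m : nat) : (j <= m)%N -> tau * delta < res m ->
  kappa * (\sum_(j <= k < m) (alpha k.+1)^-1 * res k.+1 `^ r) <=
  breg j - breg m.
Proof.
move=> /subnK <-; elim: (m - j)%N => [_|k IHk h].
  by rewrite add0n big_geq// mulr0 subrr.
rewrite addSn big_nat_recr ?leq_addl//= mulrDr.
have h' := lt_le_trans h (residual_nonincreasingS _).
by have := IHk h'; have := breg_drop h; lra.
Qed.

Lemma breg_nonincreasing (j m : nat) : (j <= m)%N -> tau * delta < res m ->
  breg m <= breg j.
Proof.
move=> jm h; rewrite -subr_ge0; apply: le_trans (breg_sum_drop jm h).
rewrite mulr_ge0 ?(ltW one_sub_inv_gt0)// sumr_ge0// => k _.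
by rewrite mulr_ge0 ?powR_ge0// invr_ge0 ltW.
Qed.

Lemma residual_decay (m : nat) : tau * delta < res m ->
  kappa * ((\sum_(0 <= k < m) (alpha k.+1)^-1) * res m `^ r) <=
  bregman Phi xi0 xd x0.
Proof.
move=> h; have := breg_sum_drop (leq0n m) h => h1.
have : breg 0 - breg m <= bregman Phi xi0 xd x0 by rewrite gerBl breg_ge0.
apply: le_trans; apply: le_trans h1; rewrite ler_pM2l ?one_sub_inv_gt0//.
rewrite mulr_suml; apply: ler_sum_nat => k /andP[_ km].
rewrite ler_pM2l ?invr_gt0//; apply: ge0_ler_powR; rewrite ?nnegrE//.
  exact: ltW.
exact: residual_nonincreasing.
Qed.

Lemma weight_le m (P : R) : res 0 <= P ->
  weight m <= (\sum_(0 <= k < m) (alpha k.+1)^-1) * P `^ (r - 1).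
Proof.
move=> h; rewrite mulr_suml; apply: ler_sum => k _.
rewrite ler_pM2l ?invr_gt0//.
have h1 : res k.+1 <= P by exact: le_trans (residual_nonincreasing _) h.
apply: ge0_ler_powR => //; rewrite nnegrE//; exact: le_trans h1.
Qed.

(** For [k < m] the residual at [m] is at most that at [k + 1], so multiplying a weight added after
    [j] by it gives at most a term of [breg_sum_drop]. *)
Lemma weight_split (j m : nat) : (j <= m)%N -> tau * delta < res m ->
  kappa * (weight m * res m) <=
  kappa * (weight j * res m) + (breg j - breg m).
Proof.
move=> jm h; apply: le_trans (lerD (lexx _) (breg_sum_drop jm h)).
rewrite -mulrDr ler_pM2l ?one_sub_inv_gt0// /weight (@big_cat_nat _ _ _ j)//.
rewrite mulrDl lerD2l.
rewrite mulr_suml; apply: ler_sum_nat => k /andP[_ km].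
rewrite -mulrA ler_pM2l ?invr_gt0// -(mulr_powRB1 (normr_ge0 _) r0) mulrC.
by apply: ler_wpM2r; [exact: powR_ge0|exact: residual_nonincreasing].
Qed.

End Solution.
End FixedDatum.

(** * Finite stopping, and smallness uniform in the data *)

Section Convergence.
Variables (y : Y) (xd : X) (tau : R).
Hypothesis hxd : minimizing_solution F Phi xi0 x0 y xd.
Hypothesis tau1 : 1 < tau.
Hypothesis alpha_sum :
  forall B, exists n, B <= \sum_(0 <= k < n) (alpha k.+1)^-1.
Local Notation iter yd n := (inett F Phi r alpha x0 xi0 yd n).
Local Notation res yd n := `|F (iter yd n).1 - yd|.
Local Notation breg yd n := (bregman Phi (iter yd n).2 xd (iter yd n).1).
Local Notation kappa := (1 - tau^-1).
Local Notation breg0 u := (bregman Phi xi0 u x0).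
Local Notation stops := (discrepancy_stop F Phi r alpha x0 xi0 tau).
Let tau0 : 0 < tau. Proof. exact: lt_trans tau1. Qed.
Let kappa0 : 0 < kappa. Proof. exact: one_sub_inv_gt0. Qed.
Let hFxd : F xd = y. Proof. exact: hxd.1. Qed.

Lemma alpha_sum_ge B (j : nat) :
  exists2 m : nat, (j <= m)%N & B <= \sum_(0 <= k < m) (alpha k.+1)^-1.
Proof.
have [n hn] := alpha_sum B; exists (maxn n j); first exact: leq_maxr.
apply: le_trans hn _; rewrite (@big_cat_nat _ _ _ n _ (maxn n j)) ?leq_maxl//=.
by rewrite lerDl sumr_ge0// => k _; rewrite invr_ge0 ltW.
Qed.

Lemma residual_uniformly_small (theta : R) (j : nat) : 0 < theta ->
  exists2 m : nat, (j <= m)%N & forall (yd : Y) (delta : R),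
    `|yd - y| <= delta -> tau * delta < res yd m -> res yd m <= theta.
Proof.
move=> th0; have p0 : 0 < kappa * theta `^ r by rewrite mulr_gt0// powR_gt0.
(* The added 1 makes the contradiction with [residual_decay] strict; [m] is fixed before the datum
   and the noise level. *)
have [m jm hm] := alpha_sum_ge ((breg0 xd + 1) / (kappa * theta `^ r)) j.
exists m => // yd delta hyd h; rewrite leNgt; apply/negP => hlt.
have hpow : theta `^ r <= res yd m `^ r.
  apply: (ge0_ler_powR (ltW r0)); rewrite ?nnegrE//; first exact: ltW th0.
  exact: ltW hlt.
have A0 : 0 <= \sum_(0 <= k < m) (alpha k.+1)^-1.
  by rewrite sumr_ge0// => k _; rewrite invr_ge0 ltW.
have := residual_decay hyd hFxd tau1 h; apply/negP; rewrite -ltNge.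
have {}hpow := ler_wpM2l (ltW kappa0) (ler_wpM2l A0 hpow).
apply: lt_le_trans hpow; rewrite mulrCA.
by move: hm; rewrite ler_pdivrMr//; apply: lt_le_trans; rewrite ltrDl.
Qed.

Lemma discrepancy_stop_exists (yd : Y) (delta : R) :
  0 < delta -> `|yd - y| <= delta -> exists n, stops delta yd n.
Proof.
move=> d0 hyd; have td0 : 0 < tau * delta by rewrite mulr_gt0.
have h : exists n, res yd n <= tau * delta.
  have [m _ hm] := residual_uniformly_small 0 td0.
  exists m; rewrite leNgt; apply/negP => h.
  by have := hm _ _ hyd h; rewrite leNgt h.
case: (ex_minnP h) => n hn minn; exists n; split=> // m.
by rewrite ltNge; apply: contraTN => /minn; rewrite -leqNgt.
Qed.

(** The set [K] is closed, bounded by coercivity, and contains no solution, since [xd] is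
    minimizing; hence [|F u - y|] has a positive minimum on it. *)
Lemma bregman_lsc (e : R) : 0 < e -> exists2 g, 0 < g &
  forall u : X, `|F u - y| <= g -> breg0 xd - breg0 u <= e.
Proof.
move=> e0; pose K := [set u : X | breg0 u <= breg0 xd - e].
have [[a Ka]|K0] := pselect (K !=set0); last first.
  exists 1 => // u _; rewrite lerBlDl -lerBlDr leNgt; apply/negP => /ltW hu.
  by apply: K0; exists u.
have cK : closed K.
  apply: (@preimage_closed _ _ (fun u => breg0 u)
    [set x : R | x <= breg0 xd - e]); last exact: closed_le.
  by move=> u _; exact: bregman_continuous.
have [B hB] := bregman_coercive huc (breg0 xd - e) hxi0.
have [|m Km hm] := @coercive_min _ _ _ K (fun u => `|F u - y|) a B cK
  (@residual_continuous _ _ _ _ _ F y) Ka.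
  by move=> x Kx _; exact: hB.
have m0 : 0 < `|F m - y|.
  rewrite normr_gt0 subr_eq0; apply/eqP => Fm.
  by have := le_trans (hxd.2 _ Fm) Km; rewrite lerBrDl gerDr leNgt e0.
exists (`|F m - y| / 2); first by rewrite divr_gt0.
move=> u hu; rewrite lerBlDl -lerBlDr leNgt; apply/negP => /ltW Ku.
have := le_trans (hm _ Ku) hu.
by rewrite ler_pdivlMr// leNgt ltr_pMr ?ltr1n.
Qed.

Let bound := `|F x0 - y| + 1.

Let res0_le (yd : Y) (delta : R) :
  `|yd - y| <= delta -> delta <= 1 -> res yd 0 <= bound.
Proof.
move=> hyd d1; rewrite -(subrKA y) (le_trans (ler_normD _ _))// lerD2l distrC.
exact: le_trans d1.
Qed.

(* Between [j] and [m], either the Bregman distance drops by [kappa * (e / 8)],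
   or the weights accumulated after [j] are harmless and it is below [e] at
   [m]. *)
Lemma breg_alternative (e K : R) : 0 < e -> forall j : nat,
  (forall (yd : Y) (delta : R), 0 < delta <= 1 -> `|yd - y| <= delta ->
    tau * delta < res yd j -> breg yd j <= Num.max e K) ->
  exists m : nat, forall (yd : Y) (delta : R), 0 < delta <= 1 ->
    `|yd - y| <= delta -> tau * delta < res yd m ->
    breg yd m <= Num.max e (K - kappa * (e / 8)).
Proof.
move=> e0 j hj; have e20 : 0 < e / 2 by rewrite divr_gt0.
have [g g0 hg] := bregman_lsc e20.
pose C := (\sum_(0 <= k < j) (alpha k.+1)^-1) * bound `^ (r - 1).
have C0 : 0 <= C.
  by rewrite mulr_ge0 ?powR_ge0// sumr_ge0// => k _; rewrite invr_ge0 ltW.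
have C1 : 0 < 8 * (C + 1) by lra.
(* As [delta] is at most the residual before stopping, the first bound gives [|F u_m - y| <= g]; the
   second makes the weights up to [j] contribute at most [e / 8]. *)
pose theta := Num.min (g / 2) (e / (8 * (C + 1))).
have th0 : 0 < theta by rewrite lt_min !divr_gt0.
have [m jm hm] := residual_uniformly_small j th0.
exists m => yd delta d01 hyd h.
have rj := residual_nonincreasing yd jm.
have := hj _ _ d01 hyd (lt_le_trans h rj).
case/andP: d01 => d0 d1 {hj}; have {hm} rm := hm _ _ hyd h.
have dr : delta <= res yd m.
  by rewrite ltW// (le_lt_trans _ h)// ler_peMl ?ltW.
have rg : res yd m <= g / 2 by rewrite (le_trans rm)// ge_min lexx.
have rC : C * res yd m <= e / 8.
  have : res yd m <= e / (8 * (C + 1)) by rewrite (le_trans rm)// ge_min lexx orbT.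
  rewrite ler_pdivlMr// => hr; have := normr_ge0 (F (iter yd m).1 - yd); lra.
have hF : `|F (iter yd m).1 - y| <= g.
  by apply: le_trans (exact_residual_le hyd _) _; lra.
have h1 := hg _ hF.
have h2 := @breg_multiplier yd y xd delta hyd hFxd m.
have h3 := weight_split hyd hFxd tau1 jm h.
have h4 : weight yd j * res yd m <= C * res yd m.
  by rewrite ler_wpM2r//; apply: weight_le; exact: res0_le d1.
have h5 : weight yd m * (res yd m + delta) <= 2 * (weight yd m * res yd m).
  by have := ler_wpM2l (weight_ge0 yd m) dr; lra.
rewrite !le_max.
(* For a small drop, weight times residual at [m] is at most [e / 8 + e / 8]; the noise doubles this
   to [e / 2], and [bregman_lsc] supplies the other [e / 2]. *)
have [lt|ge] := ltP (breg yd j - breg yd m) (kappa * (e / 8)).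
  have : kappa * (weight yd m * res yd m) <=
      kappa * (weight yd j * res yd m + e / 8) by rewrite mulrDr; lra.
  by rewrite ler_pM2l// => h6 _; apply/orP; left; lra.
have := mulr_gt0 kappa0 (divr_gt0 e0 (ltr0n _ 8)).
by move=> k8 /orP[h6|h6]; apply/orP; [left|right]; lra.
Qed.

(** Iterates [breg_alternative] from index 0, where the bound is [breg0 xd]; each round lowers it by
    [eta] until [e] takes over. *)
Lemma breg_uniformly_small (e : R) : 0 < e ->
  exists m : nat, forall (yd : Y) (delta : R), 0 < delta <= 1 ->
    `|yd - y| <= delta -> tau * delta < res yd m -> breg yd m <= e.
Proof.
move=> e0; pose eta := kappa * (e / 8).
have eta0 : 0 < eta by rewrite !(mulr_gt0, divr_gt0).
have D0 : 0 <= breg0 xd by exact: hxi0.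
have Q (K : nat) : exists m : nat, forall (yd : Y) (delta : R),
    0 < delta <= 1 -> `|yd - y| <= delta -> tau * delta < res yd m ->
    breg yd m <= Num.max e (breg0 xd - K%:R * eta).
  elim: K => [|K [j hj]].
    by exists 0%N => yd delta _ _ _; rewrite mul0r subr0 le_max lexx orbT.
  have [m hm] := breg_alternative e0 hj; exists m.
  by rewrite mulrSr mulrDl mul1r opprD addrA.
have [m hm] := Q (Num.bound (breg0 xd / eta)); exists m.
move=> yd delta d01 hyd h; apply: le_trans (hm _ _ d01 hyd h) _.
rewrite ge_max lexx/=; have := archi_boundP (divr_ge0 D0 (ltW eta0)).
by rewrite ltr_pdivrMr// => ?; lra.
Qed.

Variable c : R.
Hypothesis c0 : 0 < c.
Hypothesis alpha_le : forall n, alpha n.+1 <= c * alpha n.+2.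

(** If stopping occurs by step [nb + 2], the weights are uniformly bounded and [breg_multiplier]
    suffices. Otherwise the distance is small at [nb], does not increase until the step before
    stopping, and grows in a controlled way at the last one. *)
Lemma breg_stop_small (e : R) : 0 < e ->
  exists2 d : R, 0 < d & forall (yd : Y) (delta : R) (n : nat),
    0 < delta <= d -> `|yd - y| <= delta -> stops delta yd n ->
    breg yd n <= e.
Proof.
move=> e0; have e20 : 0 < e / 2 by rewrite divr_gt0.
have ck0 : 0 < c / kappa by rewrite divr_gt0.
(* Leaves room for the last step, which may add [c / kappa] times this amount. *)
have e'0 : 0 < e / (1 + c / kappa) by rewrite divr_gt0// addr_gt0.
have [nb hnb] := breg_uniformly_small e'0.
have [g g0 hg] := bregman_lsc e20.
pose A n := \sum_(0 <= k < n) (alpha k.+1)^-1.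
have A0 n : 0 <= A n by rewrite sumr_ge0// => k _; rewrite invr_ge0 ltW.
pose C := A nb.+2 * bound `^ (r - 1) * (tau + 1).
have t10 : 0 < tau + 1 by rewrite addr_gt0.
have C0 : 0 <= C by rewrite mulr_ge0 ?(ltW t10)// mulr_ge0 ?powR_ge0.
have C1 : 0 < C + 1 by rewrite ltr_wpDl.
(* The three bounds make [bound] apply, bring [F u_n] within [g] of [y], and keep [C * delta] below
   [e / 2]. *)
pose d := Num.min 1 (Num.min (g / (tau + 1)) (e / 2 / (C + 1))).
have d0 : 0 < d by rewrite !lt_min ltr01 !divr_gt0.
exists d => // yd delta n /andP[del0].
rewrite !le_min => /and3P[d1 d2 d3] hyd [stop nstop].
have d01 : 0 < delta <= 1 by rewrite del0.
have [nle|nlt] := leqP n nb.+2.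
  have hF : res yd n + delta <= (tau + 1) * delta by rewrite mulrDl mul1r lerD2r.
  have h1 : breg0 xd - breg0 (iter yd n).1 <= e / 2.
    apply: hg; apply: le_trans (exact_residual_le hyd _) _.
    by apply: le_trans hF _; rewrite mulrC -ler_pdivlMr.
  have h2 := @breg_multiplier yd y xd delta hyd hFxd n.
  have h3 : weight yd n <= A nb.+2 * bound `^ (r - 1).
    apply: le_trans (weight_le _ (res0_le hyd d1)) _.
    rewrite ler_wpM2r ?powR_ge0// /A (@big_cat_nat _ _ _ n _ nb.+2)//=.
    by rewrite lerDl sumr_ge0// => k _; rewrite invr_ge0 ltW.
  have h4 : weight yd n * (res yd n + delta) <= C * delta.
    rewrite /C -mulrA; apply: ler_pM => //; first exact: weight_ge0.
    by rewrite addr_ge0// ltW.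
  move: d3; rewrite ler_pdivlMr// => d3.
  by apply: le_trans h2 _; lra.
(* Here [n = m + 2] with [nb <= m], so steps [m] and [m + 1] both precede stopping. *)
case: n nlt stop nstop => // -[//|m] nlt stop nstop.
have lt1 := nstop _ (ltnSn _); have lt2 := nstop _ (ltnW (ltnSn m.+1)).
have nbm : (nb <= m)%N by rewrite -ltnS ltnW// -ltnS.
have ltb : tau * delta < res yd nb.
  by apply: lt_le_trans lt2 _; exact: residual_nonincreasing.
have hb := hnb _ _ d01 hyd ltb.
have h1 := breg_nonincreasing hyd hFxd tau1 nbm lt2.
have h2 := breg_drop hyd hFxd tau1 lt1.
have h3 := breg_ge0 yd xd m.+1.
have h4 := breg_step hyd hFxd m.+1.
have h1' : breg yd m.+1 <= breg yd m.
  by apply: (breg_nonincreasing hyd hFxd tau1).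
(* The possible increase at the last step is at most [c] times the power term of the step before,
   which [breg_drop] pays for. *)
have h5 : (alpha m.+2)^-1 *
    (res yd m.+2 `^ (r - 1) * (delta - res yd m.+2)) <=
    c * ((alpha m.+1)^-1 * res yd m.+1 `^ r).
  have dt : delta <= tau * delta by rewrite ler_peMl ?ltW.
  have td0 : 0 < tau * delta by rewrite mulr_gt0.
  apply: (@le_trans _ _ ((alpha m.+2)^-1 * res yd m.+1 `^ r)).
    rewrite ler_pM2l ?invr_gt0//.
    apply: powR_mulB_le => //; rewrite ?(ltW del0) ?normr_ge0/=.
      exact: le_trans dt (ltW lt1).
    exact: residual_nonincreasingS.
  by rewrite mulrA ler_wpM2r ?powR_ge0// ler_pdivlMr// mulrC ler_pdivrMr//.
have h6 : c * ((alpha m.+1)^-1 * res yd m.+1 `^ r) <=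
    c / kappa * (breg yd m - breg yd m.+1).
  by rewrite -mulrA ler_pM2l// ler_pdivlMl.
have h7 : c / kappa * (breg yd m - breg yd m.+1) <=
    c / kappa * (e / (1 + c / kappa)).
  by rewrite ler_pM2l// lerBlDr (le_trans h1)// (le_trans hb)// lerDl.
have eE (q : R) : 0 < q -> e = e / (1 + q) + q * (e / (1 + q)).
  by move=> q0; field; rewrite gt_eqF// addr_gt0.
apply: le_trans h4 _; rewrite (eE _ ck0); apply: lerD.
  exact: le_trans h1' (le_trans h1 hb).
exact: le_trans h5 (le_trans h6 h7).
Qed.

End Convergence.
End Iteration.

(** * The minimizing solution, and assembly of the theorem *)

(** The solution set is closed and stable under midpoints, so coercivity gives a minimizer and
    strict convexity its uniqueness. *)
Lemma minimizing_solution_unique (R : realType) (N M : nat)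
    (nuX : vnorm R N) (nuY : vnorm R M)
    (F : {linear normed_rV nuX -> normed_rV nuY}) (Phi : normed_rV nuX -> R)
    (x0 : normed_rV nuX) (xi0 : 'rV[R]_N) (y : normed_rV nuY) :
  continuous Phi -> uniformly_convex Phi -> subdifferential Phi x0 xi0 ->
  range F y -> exists! xd, minimizing_solution F Phi xi0 x0 y xd.
Proof.
move=> hcont huc hxi0 [a _ Fa].
pose A := [set x | `|F x - y| = 0].
have AE x : A x <-> F x = y.
  split=> [/eqP|Fx]; first by rewrite normr_eq0 subr_eq0 => /eqP.
  by rewrite /A/= Fx subrr normr0.
have cA : closed A.
  apply: (@preimage_closed _ _ (fun x => `|F x - y|) [set x : R | x = 0]).
    by move=> x _; exact: residual_continuous.
  exact: closed_eq.
have [B hB] := bregman_coercive huc (bregman Phi xi0 a x0) hxi0.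
have [x _|m /AE Fm hm] := @coercive_min _ _ _ A (fun x => bregman Phi xi0 x x0)
  a B cA (@bregman_continuous _ _ _ _ hcont xi0 x0) ((AE a).2 Fa); first exact: hB.
exists m; split; first by split=> // x /AE; exact: hm.
move=> z [Fz hz]; apply/eqP; apply: contraT => mz.
have := bregman_midpoint_lt huc xi0 x0 mz.
have Fh : F (2^-1 *: m + 2^-1 *: z) = y.
  rewrite linearD !linearZ/= Fm Fz -scalerDl.
  by rewrite (_ : 2^-1 + 2^-1 = 1 :> R) ?scale1r//; lra.
have h1 := hm _ ((AE _).2 Fh); have h2 := hz _ Fm.
by move=> h3; exfalso; clear Fh Fm Fz Fa; lra.
Qed.

Lemma nneseries_pinfty_partial_sum (R : realType) (s : nat -> R) :
  (forall n, 0 <= s n.+1) -> (\sum_(1 <= n <oo) (s n)%:E = +oo)%E ->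
  forall B, exists n, B <= \sum_(0 <= k < n) s k.+1.
Proof.
move=> s0 hs B; apply: contrapT => h.
suff : (\sum_(1 <= n <oo) (s n)%:E <= B%:E)%E by rewrite hs leye_eq.
apply: lime_le.
  by apply: is_cvg_ereal_nneg_natsum => -[//|n] _; rewrite lee_fin.
apply: nearW => n; rewrite sumEFin lee_fin big_add1 leNgt; apply/negP => /ltW hn.
by apply: h; exists n.-1.
Qed.

Theorem theorem5p1 (R : realType) (N M : nat)
    (nuX : vnorm R N) (nuY : vnorm R M)
    (F : {linear normed_rV nuX -> normed_rV nuY})
    (hY : uniformly_smooth (normed_rV nuY))
    (y : normed_rV nuY) (hy : range F y)
    (yd : R -> normed_rV nuY)
    (hyd : forall delta, 0 < delta -> `|yd delta - y| <= delta)
    (Phi : normed_rV nuX -> R)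
    (hnet : neural_network Phi)
    (hcont : continuous Phi)
    (huc : uniformly_convex Phi)
    (r : R) (hr : 1 < r) (tau : R) (htau : 1 < tau)
    (x0 : normed_rV nuX) (xi0 : 'rV[R]_N)
    (hxi0 : subdifferential Phi x0 xi0)
    (alpha : nat -> R)
    (halpha_pos : forall n, (1 <= n)%N -> 0 < alpha n)
    (halpha_sum : (\sum_(1 <= n <oo) ((alpha n)^-1)%R%:E = +oo)%E)
    (halpha_le : exists2 c : R, 0 < c &
       forall n, (1 <= n)%N -> alpha n <= c * alpha n.+1) :
  [/\ forall delta, 0 < delta ->
        inett_well_posed F Phi r alpha x0 xi0 (yd delta),
      exists! xdag, minimizing_solution F Phi xi0 x0 y xdag &
      exists nd : R -> nat,
        (forall delta, 0 < delta ->
           discrepancy_stop F Phi r alpha x0 xi0 tau delta (yd delta)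
             (nd delta)) /\
        forall xdag, minimizing_solution F Phi xi0 x0 y xdag ->
          [/\ (inett F Phi r alpha x0 xi0 (yd delta) (nd delta)).1
                @[delta --> 0^'+] --> xdag,
              Phi (inett F Phi r alpha x0 xi0 (yd delta) (nd delta)).1
                @[delta --> 0^'+] --> Phi xdag &
              bregman Phi (inett F Phi r alpha x0 xi0 (yd delta) (nd delta)).2
                  xdag (inett F Phi r alpha x0 xi0 (yd delta) (nd delta)).1
                @[delta --> 0^'+] --> (0 : R)]].
Proof.
have a_gt0 n : 0 < alpha n.+1 by exact: halpha_pos.
have asum := @nneseries_pinfty_partial_sum R (fun n => (alpha n)^-1)
  (fun n => ltW (etrans (invr_gt0 _) (a_gt0 n))) halpha_sum.
have [xd [hxd uxd]] := minimizing_solution_unique hcont huc hxi0 hy.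
have [c c0 hc] := halpha_le.
pose stops := discrepancy_stop F Phi r alpha x0 xi0 tau.
split.
- by move=> delta _; exact: inett_is_well_posed.
- by exists xd.
have [nd hnd] : {nd : R -> nat &
    forall delta, 0 < delta -> stops delta (yd delta) (nd delta)}.
  apply: (@choice _ _ (fun delta n => 0 < delta -> stops delta (yd delta) n)).
  (* The value 0 for [delta <= 0] is arbitrary; the limit is one-sided. *)
  move=> delta; have [d0|_] := boolP (0 < delta); last by exists 0%N.
  have [n hn] := discrepancy_stop_exists hY hcont huc hr hxi0 a_gt0 hxd htau asum
    d0 (hyd _ d0).
  by exists n.
exists nd; split=> // xd' /uxd <-{xd'}.
pose u delta := inett F Phi r alpha x0 xi0 (yd delta) (nd delta).
have hB e : 0 < e -> \forall delta \near 0^'+,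
    0 <= bregman Phi (u delta).2 xd (u delta).1 <= e.
  move=> e0; have [d d0 hd] := breg_stop_small hY hcont huc hr hxi0 a_gt0 hxd
    htau asum c0 (fun n => hc n.+1 isT) e0.
  near=> delta; have del0 : 0 < delta by [].
  apply/andP; split.
    exact: (inett_subdifferential F hY hcont huc hr hxi0 a_gt0).
  apply: hd; [|exact: hyd|exact: hnd].
  by rewrite del0/=; near: delta; exact: nbhs_right_le.
have hu : (u delta).1 @[delta --> 0^'+] --> xd.
  (* [k] depends neither on the base point nor on the subgradient, so the bound applies at the
     moving iterates: a distance of at least [e] would force a Bregman distance of at least
     [k * e]. *)
  apply/cvgrPdist_lt => e e0; have [k k0 hk] := bregman_ge_norm huc e0.
  near=> delta; rewrite ltNge; apply/negP => he.
  have h1 := hk _ _ _ (inett_subdifferential F hY hcont huc hr hxi0 a_gt0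
    (yd delta) (nd delta)) he.
  have : bregman Phi (u delta).2 xd (u delta).1 <= k * e / 2.
    suff /andP[] : 0 <= bregman Phi (u delta).2 xd (u delta).1 <= k * e / 2 by [].
    by near: delta; apply: hB; rewrite divr_gt0// mulr_gt0.
  apply/negP; rewrite -ltNge (lt_le_trans _ h1)//.
  apply: (@lt_le_trans _ _ (k * e)); last by rewrite ler_pM2l.
  by rewrite ltr_pdivrMr// ltr_pMr ?ltr1n// mulr_gt0.
split=> //.
  by apply: (@cvg_comp _ _ _ (fun delta => (u delta).1) Phi); [exact: hu|exact: hcont].
apply/cvgrPdist_le => e e0; near=> delta; rewrite sub0r normrN.
suff /andP[h1 h2] : 0 <= bregman Phi (u delta).2 xd (u delta).1 <= e.
  by rewrite ger0_norm.
by near: delta; exact: hB.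
Unshelve. all: by end_near. Qed.
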